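(* Let $n,d\ge 1$ be integers and let $F_i:\mathbb{R}^d\to\mathbb{R}$, $i\in[n]$, be differentiable with gradients $\mathbf{f}_i=\nabla F_i$. Put $F=\sum_{i=1}^n F_i$, $\mathbf{f}=\frac1n\sum_{i=1}^n\mathbf{f}_i=\frac1n\nabla F$ and $B=\{\mathbf{z}\in\mathbb{R}^d:\mathbf{f}(\mathbf{z})=\mathbf{0}\}$. Assume: (1) there is a finite constant $K\ge 0$ with $\|\mathbf{f}_i(\mathbf{z})\|\le K$ for all $\mathbf{z}\in\mathbb{R}^d$ and $i\in[n]$; (2) each $\mathbf{f}_i$, $i\in[n]$, is Lipschitz continuous on $\mathbb{R}^d$; (3) $F$ is coercive, i.e. $F(\mathbf{z})\to\infty$ as $\|\mathbf{z}\|\to\infty$; (4) $\min_{\mathbf{z}\in\mathbb{R}^d}F(\mathbf{z})$ is attained, and $B$ is a union of finitely many connected components; (5) for each $i\in[n]$, $\{\mathbf{W}_i(t)\}_t$ is a sequence of i.i.d. random vectors in $\mathbb{R}^d$, and the entries $W_i^1(t),\dots,W_i^d(t)$ of each $\mathbf{W}_i(t)$ are independent with mean $0$ and variance $1$. Let $\{a(t)\}_{t\ge0}$ be a positive non-increasing sequence with $\sum_{t=0}^\infty a(t)=\infty$ and $\sum_{t=0}^\infty a^2(t)<\infty$, and let $\{G(t)\}_{t\ge 0}$ be an $S$-strongly connected sequence of directed graphs on $[n]$. Let $\mathbf{x}_i(t),\mathbf{z}_i(t)$ be generated by the perturbed push-sum optimization algorithm with step sizes $a(t)$ over $\{G(t)\}$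 (defined in the context), and let $\bar{\mathbf{x}}(t)=\frac1n\sum_{i=1}^n\mathbf{x}_i(t)$. Then, almost surely, $\bar{\mathbf{x}}(t)$ and $\mathbf{z}_i(t)$, $i\in[n]$, converge as $t\to\infty$ either to a point of $B$ or to the boundary of one of the connected components of $B$.
   Context: Notation: $[n]=\{1,\dots,n\}$; time indices $t$ are non-negative integers. Convergence of a sequence to a set means that its distance to the set tends to $0$. Graphs: $G(t)=([n],E(t))$ is a directed graph for every $t\ge0$. The sequence $\{G(t)\}$ is $S$-strongly connected ($S\ge1$ an integer) if for every $t\ge0$ the graph $([n],E(t)\cup E(t+1)\cup\dots\cup E(t+S-1))$ is strongly connected. $N_i^{in}(t)$ and $N_i^{out}(t)$ are the in- and out-neighborhoods of node $i$ in $G(t)$; each node is always considered an in- and out-neighbor of itself. $d_i(t)$ is the out-degree of $i$, $d_i(t)=|N_i^{out}(t)|$. Perturbed push-sum optimization algorithm: starting from initial states $\mathbf{x}_i(0)\in\mathbb{R}^d$ and $y_i(0)=1$ for all $i\in[n]$, for $t\ge0$ and $i\in[n]$, $$\mathbf{w}_i(t+1)=\sum_{j\in N_i^{in}(t)}\frac{\mathbf{x}_j(t)}{d_j(t)},\quad y_i(t+1)=\sum_{j\in N_i^{in}(t)}\frac{y_j(t)}{d_j(t)},\quad \mathbf{z}_i(t+1)=\frac{\mathbf{w}_i(t+1)}{y_i(t+1)},$$ $$\mathbf{x}_i(t+1)=\mathbf{w}_i(t+1)-a(t+1)\,\mathbf{f}_i(\mathbf{z}_i(t+1))-a(t+1)\,\mathbf{W}_i(t+1).$$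 *)

(* Defs.v *)
From HB Require Import structures.
From mathcomp Require Import all_boot all_order all_algebra.
From mathcomp Require Import all_classical all_reals all_analysis.
Set Implicit Arguments.
Unset Strict Implicit.
Unset Printing Implicit Defensive.
Import Order.TTheory GRing.Theory Num.Theory.
Import numFieldNormedType.Exports.
Local Open Scope classical_set_scope.
Local Open Scope ring_scope.

(* The canonical norm of 'rV[R]_d in the library is the sup norm; it induces
   the usual topology (used for limits, closures, connectedness and
   differentiability), while metric quantities are measured with the
   Euclidean norm below. *)
Definition enorm (R : realType) (d : nat) (v : 'rV[R]_d) : R :=
  Num.sqrt (\sum_(j < d) v 0 j ^+ 2).

(* Extended-real valued, so that the distance to the empty set is +oo. *)
Definition edist_set (R : realType) (d : nat) (A : set 'rV[R]_d)
    (v : 'rV[R]_d) : \bar R :=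
  ereal_inf [set (enorm (v - u))%:E | u in A].

Definition cvg_to_set (R : realType) (d : nat) (u : nat -> 'rV[R]_d)
    (A : set 'rV[R]_d) : Prop :=
  edist_set A (u t) @[t --> \oo] --> 0%E.

Definition boundary (T : topologicalType) (A : set T) : set T :=
  closure A `\` interior A.

Definition components (T : topologicalType) (A : set T) : set (set T) :=
  [set connected_component A v | v in A].

Definition average (R : realType) (d n : nat) (v : 'I_n -> 'rV[R]_d) :
    'rV[R]_d :=
  n%:R^-1 *: \sum_(i < n) v i.

Definition grad (R : realType) (d : nat) (F : 'rV[R]_d -> R) (v : 'rV[R]_d) :
    'rV[R]_d :=
  \row_(j < d) 'D_(delta_mx 0 j) F v.

Definition elipschitz (R : realType) (d : nat) (f : 'rV[R]_d -> 'rV[R]_d) :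
    Prop :=
  exists L : R, forall u v, enorm (f u - f v) <= L * enorm (u - v).

Definition coercive (R : realType) (d : nat) (F : 'rV[R]_d -> R) : Prop :=
  forall M : R, exists r : R, forall v, r <= enorm v -> M <= F v.

(* [e i j] means that there is an arc from i to j. *)
Definition S_strongly_connected (n S : nat) (E : nat -> rel 'I_n) : Prop :=
  forall t : nat, forall i j : 'I_n,
    connect (fun u v => [exists s : 'I_S, E (t + s)%N u v]) i j.

(* Every node is its own in- and out-neighbour, whether or not the graph has a
   loop there. *)
Definition neighbor (n : nat) (e : rel 'I_n) : rel 'I_n :=
  fun i j => (i == j) || e i j.

Definition outdeg (n : nat) (e : rel 'I_n) (i : 'I_n) : nat :=
  #|[pred j | neighbor e i j]|.

(* The vector z is constrained at positive times only, w likewise. *)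
Record push_sum (R : realType) (n d : nat) (E : nat -> rel 'I_n)
    (a : nat -> R) (f : 'I_n -> 'rV[R]_d -> 'rV[R]_d)
    (W : 'I_n -> nat -> 'rV[R]_d) (x0 : 'I_n -> 'rV[R]_d)
    (x w z : 'I_n -> nat -> 'rV[R]_d) (y : 'I_n -> nat -> R) : Prop :=
  PushSum {
    push_sum_x0 : forall i, x i 0%N = x0 i ;
    push_sum_y0 : forall i, y i 0%N = 1 ;
    push_sum_w : forall i t, w i t.+1 =
      \sum_(j < n | neighbor (E t) j i) (outdeg (E t) j)%:R^-1 *: x j t ;
    push_sum_y : forall i t, y i t.+1 =
      \sum_(j < n | neighbor (E t) j i) y j t / (outdeg (E t) j)%:R ;
    push_sum_z : forall i t, z i t.+1 = (y i t.+1)^-1 *: w i t.+1 ;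
    push_sum_x : forall i t, x i t.+1 =
      w i t.+1 - a t.+1 *: f i (z i t.+1) - a t.+1 *: W i t.+1 }.

(* R^d with its Borel sigma-algebra. *)
Definition borel_rV (R : realType) (d : nat) :=
  g_sigma_algebraType (@open 'rV[R]_d).

Definition mutually_independent (dT dU : measure_display)
    (T : measurableType dT) (U : measurableType dU) (R : realType)
    (P : probability T R) (I : eqType) (X : I -> T -> U) : Prop :=
  forall (s : seq I) (A : I -> set U), uniq s ->
    (forall i, measurable (A i)) ->
    P (\bigcap_(i in [set` s]) X i @^-1` A i)
    = (\prod_(i <- s) P (X i @^-1` A i))%E.

Definition identically_distributed (dT dU : measure_display)
    (T : measurableType dT) (U : measurableType dU) (R : realType)
    (P : probability T R) (I : Type) (X : I -> {RV P >-> U}) : Prop :=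
  forall i j (A : set U), measurable A ->
    distribution P (X i) A = distribution P (X j) A.

(* Main.v *)
(* The noise of each node is i.i.d. in time, but the noises of different nodes may
   be dependent in any way, so the mean noise need not be a martingale difference
   and supermartingale arguments for F(xbar) are not available. The noise is used
   through three almost sure properties of each entry X of each W_i separately:
   sum (a X)^2 is finite, sum a X converges (Kolmogorov), and sum a r^2 is finite
   for the filter r(t+1) = (1 - a(t+1)/a(0)) r(t) + a(t+1) X(t+1). From there on
   the argument is deterministic.

   In terms of the ratios x_i/y_i, push-sum averages with row-stochastic matrices
   whose entries along the arcs are bounded below, so the spread of the ratios
   contracts over nS steps and is square summable in time.

   Adding the mean filtered noise to xbar gives a sequence v which satisfies
   v(t+1) = v(t) - a(t+1) (f(v(t)) + e(t)) with sum a |e|^2 finite. Hence F(v) is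
   bounded above, sum a |f(v)|^2 is finite, v is bounded by coercivity and f(v)
   tends to 0; the same follows for xbar.

   The limit set of xbar is connected, because the steps vanish, and contained in
   B, so it lies in one component C. If it meets the interior of C, then f
   vanishes around the walk, which from then on moves by a convergent series only,
   and so converges. Otherwise the limit set lies in the boundary of C. *)
Require Import Defs.
From HB Require Import structures.
From mathcomp Require Import all_boot all_order all_algebra.
From mathcomp Require Import all_classical all_reals all_analysis.
From mathcomp Require Import measurable_realfun ring lra.
Set Implicit Arguments.
Unset Strict Implicit.
Unset Printing Implicit Defensive.
Import Order.TTheory GRing.Theory Num.Theory.
Import numFieldNormedType.Exports.
Local Open Scope classical_set_scope.
Local Open Scope ring_scope.

(** * Series with bounded partial sums *)

(** For nonnegative terms this is summability, in a form that passes to dominated terms, sums and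
    shifts without a limit. *)
Definition bounded_sums (R : realType) (u : nat -> R) : Prop :=
  exists C, forall N, \sum_(0 <= t < N) u t <= C.

Section BoundedSums.
Variable R : realType.
Implicit Types u v : nat -> R.

Lemma bounded_sums_le u v :
  (forall t, u t <= v t) -> bounded_sums v -> bounded_sums u.
Proof.
move=> uv [C vC]; exists C => N; apply: le_trans (vC N).
by apply: ler_sum => t _.
Qed.

Lemma bounded_sumsD u v : bounded_sums u -> bounded_sums v ->
  bounded_sums (fun t => u t + v t).
Proof.
move=> [C uC] [D vD]; exists (C + D) => N.
by rewrite big_split lerD.
Qed.

Lemma bounded_sumsZ (c : R) u : 0 <= c -> bounded_sums u ->
  bounded_sums (fun t => c * u t).
Proof.
move=> c0 [C uC]; exists (c * C) => N.
by rewrite -mulr_sumr ler_wpM2l.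
Qed.

Lemma bounded_sumsS u : (forall t, 0 <= u t) -> bounded_sums u ->
  bounded_sums (fun t => u t.+1).
Proof.
move=> u0 [C uC]; exists C => N; apply: le_trans (uC N.+1).
by rewrite big_nat_recl// lerDr.
Qed.

Lemma bounded_sums_addn u k : (forall t, 0 <= u t) -> bounded_sums u ->
  bounded_sums (fun t => u (t + k)%N).
Proof.
move=> u0 bu; elim: k => [|k ih].
  by apply: bounded_sums_le bu => t; rewrite addn0.
apply: (@bounded_sums_le _ (fun t => u (t.+1 + k)%N)).
  by move=> t; rewrite addnS addSn.
exact: (@bounded_sumsS (fun t => u (t + k)%N)).
Qed.

Lemma bounded_sums_series u : (forall t, 0 <= u t) -> bounded_sums u ->
  cvgn (series u).
Proof.
move=> u0 [C uC]; apply: nondecreasing_is_cvgn.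
  by apply/nondecreasing_seqP => n; rewrite !seriesEnat/= big_nat_recr//= lerDl.
by exists C => _ [n _ <-]; rewrite seriesEnat /=.
Qed.

Lemma bounded_sums_cvg0 u : (forall t, 0 <= u t) -> bounded_sums u ->
  u t @[t --> \oo] --> 0.
Proof. by move=> u0 bu; exact/cvg_series_cvg_0/bounded_sums_series. Qed.

Lemma bounded_sums_tail u (e : R) : (forall t, 0 <= u t) -> bounded_sums u ->
  0 < e -> exists m, forall k, \sum_(0 <= i < k) u (m + i)%N <= e.
Proof.
move=> u0 bu e0; have /cvg_ex[l ul] := bounded_sums_series u0 bu.
have ndu : nondecreasing_seq (series u).
  by apply/nondecreasing_seqP => n; rewrite !seriesEnat/= big_nat_recr//= lerDl.
have le_l n : series u n <= l.
  by rewrite -(cvg_lim _ ul)//; apply: nondecreasing_cvgn_le => //; apply/cvg_ex; exists l.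
move/cvgrPdist_le : (ul) => /(_ _ e0)[m _ /(_ m (leqnn m)) ml].
have {}ml : l - series u m <= e.
  by apply: le_trans ml; rewrite ler_norm.
exists m => k; have := le_l (m + k)%N; move: ml; rewrite !seriesEnat/=.
rewrite (big_cat_nat (leq0n m) (leq_addr k m))/=.
have -> : \sum_(m <= i < m + k) u i = \sum_(0 <= i < k) u (m + i)%N.
  rewrite -{1}[m]add0n big_addn addKn.
  by apply: eq_bigr => i _; rewrite addnC.
by lra.
Qed.

Lemma bounded_sumsM u v : bounded_sums (fun t => u t ^+ 2) ->
  bounded_sums (fun t => v t ^+ 2) -> bounded_sums (fun t => `|u t * v t|).
Proof.
move=> bu bv; have := bounded_sumsD bu bv; apply: bounded_sums_le => t.
by rewrite ler_norml; apply/andP; split; nra.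
Qed.

Lemma bounded_sums_nneseries u : (forall t, 0 <= u t) ->
  (\sum_(0 <= t <oo) (u t)%:E < +oo)%E -> bounded_sums u.
Proof.
move=> u0 uoo; exists (fine (\sum_(0 <= t <oo) (u t)%:E)) => N.
rewrite -lee_fin fineK; last first.
  by rewrite ge0_fin_numE//; apply: nneseries_ge0 => t _ _; rewrite lee_fin.
rewrite -sumEFin; apply: (le_trans _ (nneseries_lim_ge N _)) => //.
by move=> t _ _; rewrite lee_fin.
Qed.

Lemma bounded_sums_lty u : (forall t, 0 <= u t) -> bounded_sums u ->
  (\sum_(0 <= t <oo) (u t)%:E < +oo)%E.
Proof.
move=> u0 [C uC]; apply: (@le_lt_trans _ _ C%:E); last exact: ltry.
apply: lime_le => //.
  by apply: is_cvg_nneseries => t _ _; rewrite lee_fin.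
by apply: nearW => N; rewrite sumEFin lee_fin.
Qed.

End BoundedSums.
(** * Weighted sums of independent variables *)

(** Independence identifies the joint law of [(Z, X)] with the product of the two laws. Tonelli then
    gives integrability, and integrating first over [X] gives zero. The target of [Z] is arbitrary
    so that [Z] can be the identity into a coarser sigma-algebra. *)
Lemma integral_mul_indep (dO d1 : measure_display) (Omega : measurableType dO)
    (T : measurableType d1) (R : realType) (P : probability Omega R)
    (Z : {mfun Omega >-> T}) (X : {mfun Omega >-> R}) (phi : T -> R) :
    (forall A B, measurable A -> measurable B ->
       P (Z @^-1` A `&` X @^-1` B) = (P (Z @^-1` A) * P (X @^-1` B))%E) ->
    measurable_fun setT phi ->
    P.-integrable setT (EFin \o (phi \o Z)) ->
    P.-integrable setT (EFin \o X) ->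
    (\int[P]_om (X om)%:E = 0)%E ->
  P.-integrable setT (fun om => (phi (Z om) * X om)%:E) /\
  (\int[P]_om (phi (Z om) * X om)%:E = 0)%E.
Proof.
move=> indep mphi iphi iX X0.
pose ZX om := (Z om, X om).
have mZX : measurable_fun setT ZX by apply: measurable_fun_pair.
pose mZXm := isMeasurableFun.Build _ _ _ _ _ mZX.
pose ZX' : {mfun Omega >-> (T * R)%type} := HB.pack ZX mZXm.
pose m1 := distribution P Z; pose m2 := distribution P X.
pose g (q : T * R) : \bar R := (phi q.1 * q.2)%:E.
have mg : measurable_fun [set: (T * R)%type] g.
  apply/measurable_EFinP; apply: measurable_funM.
    exact: measurableT_comp.
  exact: measurable_snd.
have prodE : forall A, measurable A -> (m1 \x m2)%E A = distribution P ZX' A.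
  apply: product_measure_unique => A B mA mB.
  rewrite /m1 /m2 /distribution /pushforward -indep//; congr (P _).
have eqI h : (\int[m1 \x m2]_q h q = \int[distribution P ZX']_q h q)%E.
  by apply: eq_measure_integral => A mA _; exact: prodE.
have ig : (m1 \x m2)%E.-integrable setT g.
  apply/integrable12ltyP => //.
  have mabs : measurable_fun setT (fun r : R => `|r|%:E).
    by apply/measurable_EFinP; exact: normr_measurable.
  have mphia : measurable_fun setT (fun q => `|phi q|%:E).
    by apply/measurable_EFinP; exact: measurableT_comp.
  have -> : (fun q => \int[m2]_r `|g (q, r)|)%E =
      (fun q => `|phi q|%:E * \int[m2]_r `|r|%:E)%E.
    apply/funext => q; rewrite -ge0_integralZl//.
    by apply: eq_integral => r _; rewrite /g/= normrM EFinM.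
  rewrite ge0_integralZr//; last exact: integral_ge0.
  rewrite !ge0_integral_pushforward//=.
  apply: lte_mul_pinfty.
  - exact: integral_ge0.
  - rewrite ge0_fin_numE; last exact: integral_ge0.
    by move/integrableP : iphi => [].
  - by move/integrableP : iX => [].
have ig' : P.-integrable setT (g \o ZX').
  have := ig => /integrableP[_].
  rewrite eqI ge0_integral_pushforward//=; last first.
    by apply: (measurableT_comp (g := g) (f := abse)).
  move=> h; apply/integrableP; split => //.
  exact: measurableT_comp.
split; first exact: ig'.
transitivity (\int[distribution P ZX']_q g q)%E.
  by rewrite integral_pushforward.
rewrite -eqI -integral12_prod_meas1//= /fubini_F /g/=.
have intX : (\int[m2]_r r%:E = 0)%E.
  by rewrite integral_pushforward//=; exact/measurable_EFinP.
have iX2 : m2.-integrable setT EFin.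
  by apply: integrable_pushforward => //=; exact/measurable_EFinP.
under eq_integral => q _ do rewrite (integralZl measurableT iX2) intX mule0.
by rewrite integral0.
Qed.

(* A pi-system generating the sigma-algebra of [X 0], ..., [X (t - 1)]. *)
Definition past (T : pointedType) (R : realType) (X : nat -> T -> R) (t : nat) :
    set (set T) :=
  [set B | exists2 A : nat -> set R, (forall s, measurable (A s)) &
     B = \bigcap_(s in `I_t) X s @^-1` A s].

Lemma past_measurable (d : measure_display) (T : measurableType d)
    (R : realType) (X : nat -> T -> R) (t : nat) :
    (forall s, measurable_fun setT (X s)) ->
  past X t `<=` measurable.
Proof.
move=> mX _ [A mA ->]; apply: bigcap_measurableType => // s _.
by rewrite -[X in measurable X]setTI; exact: mX.
Qed.

Lemma past_sub_measurable (d : measure_display) (T : measurableType d)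
    (R : realType) (X : nat -> T -> R) (t : nat) :
    (forall s, measurable_fun setT (X s)) ->
  <<s past X t >> `<=` measurable.
Proof.
move=> mX.
exact: (smallest_sub (@sigma_algebra_measurable _ T) (past_measurable mX)).
Qed.

Lemma measurable_past (d : measure_display) (T : measurableType d)
    (R : realType) (X : nat -> T -> R) (s t : nat) : (s < t)%N ->
  measurable_fun setT (X s : g_sigma_algebraType (past X t) -> R).
Proof.
move=> st _ A mA; rewrite setTI; apply: sub_sigma_algebra.
exists (fun k => if k == s then A else setT).
  by move=> k; case: ifP.
apply/seteqP; split=> [om /= Aom k _|om /(_ s st)/=]; last by rewrite eqxx.
by case: eqP => // ->.
Qed.

(** With D the event on [X t], restricting [P] to D and scaling [P] by the probability of D give two
    finite measures. They agree on the pi-system [past X t] by mutual independence, hence on the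
    sigma-algebra that it generates. *)
Lemma past_indep (d : measure_display) (T : measurableType d) (R : realType)
    (P : probability T R) (X : nat -> T -> R) (t : nat) (A : set R)
    (B : set T) :
    (forall s, measurable_fun setT (X s)) -> mutually_independent P X ->
    measurable A -> <<s past X t >> B ->
  P (B `&` X t @^-1` A) = (P B * P (X t @^-1` A))%E.
Proof.
move=> mX indep mA sB.
have mD : measurable (X t @^-1` A).
  by rewrite -[X in measurable X]setTI; exact: mX.
have PD : (fine (P (X t @^-1` A)))%:E = P (X t @^-1` A).
  by rewrite fineK// fin_num_measure.
pose c := NngNum (fine_ge0 (measure_ge0 P (X t @^-1` A))).
have mscE C : mscale c P C = (P C * P (X t @^-1` A))%E.
  by rewrite /mscale/= PD muleC.
rewrite -mscE.
rewrite -[LHS]/(mrestr P mD B).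
apply: (g_sigma_algebra_measure_unique (past X t) _ (fun=> setT)) => //.
- exact: past_measurable.
- move=> _; exists (fun=> setT) => //.
  by apply/seteqP; split.
- by rewrite bigcup_const//; exists 0%N.
- move=> _ _ [A1 mA1 ->] [A2 mA2 ->]; exists (fun s => A1 s `&` A2 s).
    by move=> s; exact: measurableI.
  by apply/seteqP; split=> [om [h1 h2] s st|om h]; [split; [exact: h1|exact: h2]|
    split=> s st; have [] := h s st].
- move=> _ [A1 mA1 ->]; rewrite [RHS]mscE /= /mrestr.
  (* Placing [A] at index [t] lets one family serve for the times below [t] and for those below
     [t.+1]; the two product formulas differ by the factor of [X t]. *)
  pose A' s := if s == t then A else A1 s.
  have mA' s : measurable (A' s) by rewrite /A'; case: ifP.
  have := indep (iota 0 t.+1) A' (iota_uniq _ _) mA'.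
  have := indep (iota 0 t) A' (iota_uniq _ _) mA'.
  have iotaE u : [set` iota 0 u] = `I_u.
    by apply/seteqP; split=> s; rewrite /= mem_iota.
  rewrite !iotaE.
  have -> : \bigcap_(i in `I_t) X i @^-1` A' i =
            \bigcap_(i in `I_t) X i @^-1` A1 i.
    by apply: eq_bigcapr => s /= st; rewrite /A' ltn_eqF.
  have -> : \bigcap_(i in `I_t.+1) X i @^-1` A' i =
            (\bigcap_(i in `I_t) X i @^-1` A1 i) `&` X t @^-1` A.
    apply/seteqP; split=> om.
      move=> h; split=> [s /= st|].
        by have := h s (ltnW st); rewrite /= /A' ltn_eqF.
      by have := h t (leqnn _); rewrite /= /A' eqxx.
    move=> [h1 h2] s /=; rewrite ltnS leq_eqVlt /A'.
    by case: eqP => [->//|_ /= st]; exact: h1.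
  move=> -> ->.
  rewrite (_ : iota 0 t.+1 = rcons (iota 0 t) t); last first.
    by rewrite -addn1 iotaD /= add0n cats1.
  by rewrite big_rcons/= /A' eqxx muleC.
- by move=> _; rewrite /= /mrestr setTI ltey_eq fin_num_measure.
Qed.

(** The identity into the same set, equipped with the sigma-algebra of the past, is a random
    variable. A past-measurable [phi] is a function of it, so [integral_mul_indep] applies. *)
Lemma past_orthogonal (d : measure_display) (T : measurableType d)
    (R : realType) (P : probability T R) (X : nat -> T -> R) (t : nat)
    (phi : T -> R) :
    (forall s, measurable_fun setT (X s)) -> mutually_independent P X ->
    measurable_fun setT (phi : g_sigma_algebraType (past X t) -> R) ->
    P.-integrable setT (EFin \o phi) ->
    P.-integrable setT (EFin \o X t) ->
    (\int[P]_om (X t om)%:E = 0)%E ->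
  P.-integrable setT (fun om => (phi om * X t om)%:E) /\
  (\int[P]_om (phi om * X t om)%:E = 0)%E.
Proof.
move=> mX indep mphi iphi iX X0.
pose G := g_sigma_algebraType (past X t).
have mid : @measurable_fun _ _ T G setT id.
  move=> _ B mB; rewrite setTI preimage_id.
  exact: past_sub_measurable mX _ mB.
pose midm := isMeasurableFun.Build _ _ T G _ mid.
pose Z : {mfun T >-> G} := HB.pack (id : T -> G) midm.
pose mXm := isMeasurableFun.Build _ _ _ _ _ (mX t).
pose X' : {mfun T >-> R} := HB.pack (X t) mXm.
apply: (@integral_mul_indep _ _ T G R P Z X' phi) => //.
by move=> A B mA mB /=; rewrite preimage_id; exact: past_indep.
Qed.

(** In the expanded square the cross term has integral 0 because [phi * psi] is determined by the
    past, and the last term contributes at most [c ^+ 2]. This serves the filter, where [psi] is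
    constant, and the stopped sums, where [psi] may be switched off. *)
Lemma integral_sqr_step (d : measure_display) (T : measurableType d)
    (R : realType) (P : probability T R) (X : nat -> T -> R) (t : nat)
    (phi psi : T -> R) (c : R) :
    (forall s, measurable_fun setT (X s)) -> mutually_independent P X ->
    (\int[P]_om (X t om)%:E = 0)%E -> (\int[P]_om (X t om ^+ 2)%:E = 1)%E ->
    measurable_fun setT (phi : g_sigma_algebraType (past X t) -> R) ->
    measurable_fun setT (psi : g_sigma_algebraType (past X t) -> R) ->
    (forall om, `|psi om| <= c) ->
    (\int[P]_om (phi om ^+ 2)%:E < +oo)%E ->
  (\int[P]_om ((phi om + psi om * X t om) ^+ 2)%:E <=
   \int[P]_om (phi om ^+ 2)%:E + (c ^+ 2)%:E)%E.
Proof.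
move=> mX indep X0 X1 mphi mpsi psic phioo.
have sub := past_sub_measurable (t := t) mX.
have toT g : measurable_fun setT (g : g_sigma_algebraType (past X t) -> R) ->
    measurable_fun [set: T] g.
  by move=> mg _ B mB; apply: sub; exact: mg.
have mphiT := toT _ mphi; have mpsiT := toT _ mpsi.
have sqr_int (g : T -> R) : measurable_fun setT g ->
    (\int[P]_om (g om ^+ 2)%:E < +oo)%E ->
    P.-integrable setT (fun om => (g om ^+ 2)%:E).
  move=> mg goo; apply/integrableP; split.
    by apply/measurable_EFinP; exact: measurable_funX.
  rewrite (eq_integral (fun om => (g om ^+ 2)%:E))// => om _ /=.
  by rewrite ger0_norm// sqr_ge0.
have int_le (g h : T -> R) : measurable_fun setT g ->
    (forall om, `|g om| <= h om) -> P.-integrable setT (EFin \o h) ->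
    P.-integrable setT (EFin \o g).
  move=> mg gh; apply: le_integrable => //; first exact/measurable_EFinP.
  move=> om _ /=; rewrite lee_fin (le_trans (gh om))//; exact: ler_norm.
have i1 : P.-integrable setT (EFin \o (fun=> 1 : R)).
  exact: finite_measure_integrable_cst.
have sq1_int (g : T -> R) : measurable_fun setT g ->
    P.-integrable setT (fun om => (g om ^+ 2)%:E) ->
    P.-integrable setT (EFin \o (fun om => 1 + g om ^+ 2)).
  move=> mg ig; rewrite (_ : _ \o _ =
    ((EFin \o (fun=> 1%R : R)) \+ (fun om => (g om ^+ 2)%:E))%E).
    exact: integrableD.
  by apply/funext => om /=; rewrite EFinD.
have iphi2 := sqr_int _ mphiT phioo.
have iX2 : P.-integrable setT (fun om => (X t om ^+ 2)%:E).
  by apply: sqr_int => //; rewrite X1 ltry.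
have iX : P.-integrable setT (EFin \o X t).
  apply: (int_le _ (fun om => 1 + X t om ^+ 2)) => //; last exact: sq1_int.
  by move=> om; rewrite ler_norml; apply/andP; split; nra.
have c0 : 0 <= c by apply: le_trans (psic point).
have iphi : P.-integrable setT (EFin \o (fun om => 2 * (phi om * psi om))).
  apply: (int_le _ (fun om => 2 * c * (1 + phi om ^+ 2))).
  - by apply: measurable_funM => //; exact: measurable_funM.
  - move=> om; rewrite normrM ger0_norm// -mulrA ler_wpM2l// normrM mulrC.
    rewrite ler_pM//.
    by rewrite ler_norml; apply/andP; split; nra.
  - have -> : EFin \o (fun om => 2 * c * (1 + phi om ^+ 2)) =
        (fun om => (2 * c)%:E * (EFin \o (fun om => 1 + phi om ^+ 2)%R) om)%E.
      by apply/funext => om /=; rewrite EFinM.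
    by apply: integrableZl => //; exact: sq1_int.
have [] := @past_orthogonal _ T R P X t (fun om => 2 * (phi om * psi om)) mX indep _ iphi iX X0.
  by apply: measurable_funM => //; exact: measurable_funM.
move=> icross cross0.
have ipsi2 : P.-integrable setT (fun om => (psi om ^+ 2 * X t om ^+ 2)%:E).
  apply: (int_le _ (fun om => c ^+ 2 * X t om ^+ 2)).
  - by apply: measurable_funM; exact: measurable_funX.
  - move=> om; rewrite normrM ler_pM//; last by rewrite ger0_norm// sqr_ge0.
    by rewrite normrX lerXn2r ?nnegrE.
  - have -> : EFin \o (fun om => c ^+ 2 * X t om ^+ 2) =
        (fun om => (c ^+ 2)%:E * (X t om ^+ 2)%:E)%E.
      by apply/funext => om /=; rewrite EFinM.
    exact: integrableZl.
have -> : (\int[P]_om ((phi om + psi om * X t om) ^+ 2)%:E =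
   \int[P]_om (phi om ^+ 2)%:E + (\int[P]_om (2 * (phi om * psi om) * X t om)%:E +
   \int[P]_om (psi om ^+ 2 * X t om ^+ 2)%:E))%E.
  rewrite -integralD// -integralD//; last exact: integrableD.
  by apply: eq_integral => om _ /=; rewrite -!EFinD; congr EFin; ring.
rewrite cross0 add0e leeD2l//.
apply: (@le_trans _ _ (\int[P]_om ((c ^+ 2)%:E * (X t om ^+ 2)%:E)))%E.
  apply: ge0_le_integral => //.
  - by move=> om _; rewrite lee_fin mulr_ge0 ?sqr_ge0.
  - by case/integrableP : ipsi2.
  - by under eq_fun do rewrite -EFinM; apply/measurable_EFinP/measurable_funM => //; exact: measurable_funX.
  - move=> om _; rewrite -EFinM lee_fin ler_wpM2r ?sqr_ge0//.
    by rewrite -(real_normK (num_real (psi om))) lerXn2r ?nnegrE.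
by rewrite integralZl// X1 mule1.
Qed.

(* Unlike the partial sums of [a t * X t], whose distances to their limit need
   not be square summable with weights [a], the filtered noise is. *)
Fixpoint lowpass (R : realType) (b a X : nat -> R) (n : nat) : R :=
  if n is m.+1 then (1 - b n) * lowpass b a X m + a n * X n else 0.

(* Freezing the sums at level [e] plays the part of the stopping time in
   Kolmogorov's maximal inequality. *)
Fixpoint stopped (R : realType) (e : R) (a X : nat -> R) (m k : nat) : R :=
  if k is l.+1 then
    stopped e a X m l +
    (if `|stopped e a X m l| < e then a (m + l)%N else 0) * X (m + l)%N
  else 0.

Lemma stopped_frozen (R : realType) (e : R) (a X : nat -> R) (m k l : nat) :
  e <= `|stopped e a X m k| -> (k <= l)%N -> e <= `|stopped e a X m l|.
Proof.
move=> ek; elim: l => [|l ih]; first by rewrite leqn0 => /eqP <-.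
rewrite leq_eqVlt => /orP[/eqP <-//|/ih el] /=.
by rewrite ltNge el /= mul0r addr0.
Qed.

Lemma stoppedE (R : realType) (e : R) (a X : nat -> R) (m k : nat) :
  (forall l, `|stopped e a X m l| < e) ->
  stopped e a X m k = \sum_(0 <= i < k) a (m + i)%N * X (m + i)%N.
Proof.
move=> small; elim: k => [|k ih]; first by rewrite big_nil.
by rewrite big_nat_recr//= small ih.
Qed.

Lemma sqr_onem_le (R : realType) (x : R) : 0 <= x <= 1 -> (1 - x) ^+ 2 <= 1 - x.
Proof. by case/andP; nra. Qed.

Section WeightedIndependentSums.
Context (d : measure_display) (T : measurableType d) (R : realType).
Variable P : probability T R.

(** By monotone convergence the integral of the series is at most the sum of the [m t], so the
    series is finite almost everywhere. *)
Lemma ae_bounded_sums (u : nat -> T -> R) (m : nat -> R) :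
    (forall t om, 0 <= u t om) -> (forall t, measurable_fun setT (u t)) ->
    (forall t, \int[P]_om (u t om)%:E <= (m t)%:E)%E -> bounded_sums m ->
  {ae P, forall om, bounded_sums (u^~ om)}.
Proof.
move=> u0 mu um bm.
have m0 t : 0 <= m t.
  rewrite -lee_fin (le_trans _ (um t))//.
  by apply: integral_ge0 => om _; rewrite lee_fin.
pose U om := (\sum_(0 <= t <oo) (u t om)%:E)%E.
have mut t : measurable_fun setT (fun om => (u t om)%:E) by exact/measurable_EFinP.
have iU : P.-integrable setT U.
  apply/integrableP; split.
    by apply: ge0_emeasurable_sum => // t om _ _; rewrite lee_fin.
  rewrite (eq_integral U); last first.
    by move=> om _; rewrite gee0_abs// nneseries_ge0// => t _ _; rewrite lee_fin.
  rewrite integral_nneseries//; last by move=> t om _; rewrite lee_fin.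
  apply: le_lt_trans (bounded_sums_lty m0 bm).
  apply: lee_nneseries => t _ //.
  by move=> _; apply: integral_ge0 => om _; rewrite lee_fin.
have := integrable_ae measurableT iU; apply: filterS => om /(_ I) Uom.
apply: bounded_sums_nneseries => //.
by move: Uom; rewrite ge0_fin_numE// nneseries_ge0// => t _ _; rewrite lee_fin.
Qed.

Variables (X : nat -> T -> R) (a : nat -> R).
Hypothesis mX : forall t, measurable_fun setT (X t).
Hypothesis indep : mutually_independent P X.
Hypothesis X_mean : forall t, (\int[P]_om (X t om)%:E = 0)%E.
Hypothesis X_sqr : forall t, (\int[P]_om (X t om ^+ 2)%:E = 1)%E.
Hypothesis a_sqr : bounded_sums (fun t => a t ^+ 2).

Lemma ae_bounded_sums_sqr :
  {ae P, forall om, bounded_sums (fun t => (a t * X t om) ^+ 2)}.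
Proof.
apply: (ae_bounded_sums (u := fun t om => (a t * X t om) ^+ 2) _ _ _ a_sqr).
- by move=> t om; exact: sqr_ge0.
- by move=> t; apply: measurable_funX; exact: measurable_funM.
- move=> t.
  under eq_integral do rewrite exprMn EFinM.
  rewrite ge0_integralZl//.
  + by rewrite X_sqr mule1.
  + by apply/measurable_EFinP; exact: measurable_funX.
  + by move=> om _; rewrite lee_fin sqr_ge0.
  + by rewrite lee_fin sqr_ge0.
Qed.

Lemma measurable_past_lowpass (b : nat -> R) (n t : nat) : (n < t)%N ->
  measurable_fun setT
    ((fun om => lowpass b a (X^~ om) n) : g_sigma_algebraType (past X t) -> R).
Proof.
elim: n => [_|n ih nt] /=; first exact: measurable_cst.
apply: measurable_funD; apply: measurable_funM => //.
  by apply: ih; exact: ltnW.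
exact: measurable_past.
Qed.

(** One step multiplies the second moment by [(1 - b) ^+ 2 <= 1 - b] and adds [a ^+ 2], so the
    second moments are dominated by the same filter fed with the squares of [a] at gain 1. *)
Lemma lowpass_variance (b : nat -> R) (n : nat) :
    (forall t, 0 <= b t <= 1) ->
  (\int[P]_om (lowpass b a (X^~ om) n ^+ 2)%:E <=
   (lowpass b (fun=> 1) (fun t => a t ^+ 2) n)%:E)%E.
Proof.
move=> b01; elim: n => [|n ih] /=.
  by under eq_integral do rewrite expr0n/=; rewrite integral0.
set r := fun om => lowpass b a (X^~ om) n.
have mr : measurable_fun setT (r : g_sigma_algebraType (past X n.+1) -> R).
  exact: measurable_past_lowpass.
have sqE : (\int[P]_om (((1 - b n.+1) * r om) ^+ 2)%:E =
    ((1 - b n.+1) ^+ 2)%:E * \int[P]_om (r om ^+ 2)%:E)%E.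
  under eq_integral do rewrite exprMn EFinM.
  rewrite ge0_integralZl// ?lee_fin ?sqr_ge0//.
  - apply/measurable_EFinP; apply: measurable_funX.
    move=> _ B mB; apply: (past_sub_measurable (t := n.+1) mX); exact: mr.
  - by move=> om _; rewrite lee_fin sqr_ge0.
have := @integral_sqr_step _ T R P X n.+1 (fun om => (1 - b n.+1) * r om)
  (fun=> a n.+1) `|a n.+1| mX indep (X_mean _) (X_sqr _).
rewrite sqE => step; apply: (le_trans (step _ _ _ _)) => //.
- by apply: measurable_funM => //; exact: measurable_cst.
- apply: lte_mul_pinfty => //; first by rewrite lee_fin sqr_ge0.
  exact: (le_lt_trans ih (ltry _)).
- rewrite mul1r EFinD real_normK ?num_real// leeD2r//.
  apply: (le_trans (lee_wpmul2l _ ih)); first by rewrite lee_fin sqr_ge0.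
  rewrite -EFinM lee_fin ler_wpM2r//; last exact: sqr_onem_le.
  rewrite -lee_fin (le_trans _ ih)//.
  by apply: integral_ge0 => om _; rewrite lee_fin sqr_ge0.
Qed.

(** The variance bound [q] loses [b t.+1 * q t] and gains [a t.+1 ^+ 2] at each step. Losses up to
    [N] plus the remaining stock [q N] thus equal a partial sum of the squares of [a]. *)
Lemma ae_bounded_sums_lowpass (b : nat -> R) :
    (forall t, 0 <= b t <= 1) ->
  {ae P, forall om,
    bounded_sums (fun t => b t.+1 * lowpass b a (X^~ om) t ^+ 2)}.
Proof.
move=> b01; have b0 t : 0 <= b t by case/andP: (b01 t).
have mr n : measurable_fun setT (fun om => lowpass b a (X^~ om) n).
  move=> _ B mB; apply: (past_sub_measurable (t := n.+1) mX); exact: measurable_past_lowpass.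
set q := lowpass b (fun=> 1) (fun t => a t ^+ 2).
apply: (ae_bounded_sums (u := fun t om => b t.+1 * lowpass b a (X^~ om) t ^+ 2)
  (m := fun t => b t.+1 * q t)).
- by move=> t om; rewrite mulr_ge0// sqr_ge0.
- by move=> t; apply: measurable_funM => //; exact: measurable_funX.
- move=> t; under eq_integral do rewrite EFinM.
  rewrite ge0_integralZl// ?lee_fin//.
  + by rewrite EFinM; apply: lee_wpmul2l; [rewrite lee_fin|exact: lowpass_variance].
  + by apply/measurable_EFinP; exact: measurable_funX.
  + by move=> om _; rewrite lee_fin sqr_ge0.
- have [C aC] := bounded_sumsS (fun t => sqr_ge0 (a t)) a_sqr.
  exists C => N; apply: le_trans (aC N).
  have q0 n : 0 <= q n.
    rewrite /q; elim: n => //= n ih; have /andP[_ b1] := b01 n.+1.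
    by rewrite mul1r addr_ge0 ?sqr_ge0// mulr_ge0 ?subr_ge0.
  suff : \sum_(0 <= t < N) b t.+1 * q t + q N = \sum_(0 <= t < N) a t.+1 ^+ 2.
    by move=> <-; rewrite lerDl.
  elim: N => [|N ih]; first by rewrite !big_nil add0r.
  by rewrite !big_nat_recr//= -ih /q /=; ring.
Qed.

Lemma measurable_past_stopped (e : R) (m k t : nat) : (m + k <= t)%N ->
  measurable_fun setT
    ((fun om => stopped e a (X^~ om) m k) : g_sigma_algebraType (past X t) -> R).
Proof.
elim: k => [_|k ih mkt] /=; first exact: measurable_cst.
rewrite addnS in mkt; have mS := ih (ltnW mkt).
apply: measurable_funD => //; apply: measurable_funM; last exact: measurable_past.
apply: measurable_fun_ifT => //; apply: measurable_fun_ltr => //.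
by apply: measurableT_comp mS.
Qed.

(** Whether the sum is already frozen is decided by the past, so the switched coefficient is
    admissible in [integral_sqr_step]. *)
Lemma stopped_variance (e : R) (m k : nat) :
  (\int[P]_om (stopped e a (X^~ om) m k ^+ 2)%:E <=
   (\sum_(0 <= i < k) a (m + i)%N ^+ 2)%:E)%E.
Proof.
elim: k => [|k ih].
  by rewrite big_nil; under eq_integral do rewrite /= expr0n/=; rewrite integral0.
have mS := @measurable_past_stopped e m k (m + k)%N (leqnn _).
have := @integral_sqr_step _ T R P X (m + k)%N (fun om => stopped e a (X^~ om) m k)
  (fun om => if `|stopped e a (X^~ om) m k| < e then a (m + k)%N else 0)
  `|a (m + k)%N| mX indep (X_mean _) (X_sqr _).
move=> step; apply: (le_trans (step _ _ _ _)) => //.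
- apply: measurable_fun_ifT => //; apply: measurable_fun_ltr => //.
  by apply: measurableT_comp mS.
- by move=> om; case: ifP => // _; rewrite normr0.
- exact: (le_lt_trans ih (ltry _)).
- by rewrite big_nat_recr//= EFinD real_normK ?num_real// leeD2r.
Qed.

(** Chebyshev's inequality for the stopped sums bounds the probability that the sums beyond [m] ever
    deviate by [e], and the bound vanishes with the tail of the squares of [a]. Hence the sums are
    almost surely Cauchy. *)
Lemma ae_cvg_weighted_sum :
  {ae P, forall om, cvgn (fun N => \sum_(0 <= t < N) a t * X t om)}.
Proof.
(* Because of the freezing, this is the event that the sums started at [m] have reached level [e]
   within [k] terms. *)
pose A e m k := [set om | e <= `|stopped e a (X^~ om) m k|].
have mS e m k : measurable_fun setT (fun om => stopped e a (X^~ om) m k).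
  move=> _ B mB; apply: (past_sub_measurable (t := (m + k)%N) mX); exact: measurable_past_stopped.
have mA e m k : measurable (A e m k).
  rewrite -[A e m k]setTI; apply: measurable_fun_le => //.
  by apply: measurableT_comp (mS e m k).
have PA e m k : 0 < e ->
    ((e ^+ 2)%:E * P (A e m k) <= (\sum_(0 <= i < k) a (m + i)%N ^+ 2)%:E)%E.
  move=> e0; apply: le_trans (stopped_variance e m k).
  have e20 : 0 < e ^+ 2 by rewrite exprn_gt0.
  have := @le_integral_abse _ T R P setT measurableT
    (fun om => (stopped e a (X^~ om) m k ^+ 2)%:E) (e ^+ 2).
  move=> /(_ _ e20); rewrite setTI => h.
  have -> : A e m k =
      [set om | ((e ^+ 2)%:E <= `|(stopped e a (X^~ om) m k ^+ 2)%:E|)%E].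
    apply/seteqP; split=> om /=; rewrite lee_fin normrX ler_sqr ?nnegrE//.
    - exact: ltW.
    - exact: ltW.
  apply: (le_trans (h _)).
    by apply/measurable_EFinP; apply: measurable_funX.
  rewrite (eq_integral (fun om => (stopped e a (X^~ om) m k ^+ 2)%:E))// => om _ /=.
  by rewrite ger0_norm// sqr_ge0.
(* The event that the Cauchy property fails at scale [e]: from every start [m] the sums eventually
   deviate by at least [e]. *)
pose N e := \bigcap_m \bigcup_k A e m k.
have mN e : measurable (N e).
  by apply: bigcapT_measurable => m; apply: bigcupT_measurable.
have N0 e : 0 < e -> P (N e) = 0%E.
  move=> e0; apply/eqP; rewrite -measure_le0; apply/lee_addgt0Pr => eta eta0.
  rewrite add0e.
  have e20 : 0 < e ^+ 2 by rewrite exprn_gt0.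
  have [m tail] := bounded_sums_tail (fun t => sqr_ge0 (a t)) a_sqr (mulr_gt0 e20 eta0).
  apply: (@le_trans _ _ (P (\bigcup_k A e m k))).
    by apply: le_measure; rewrite ?inE//; [exact: bigcupT_measurable|exact: bigcap_inf].
  (* The events grow with [k], so the probability of their union is a limit of probabilities, each
     at most [eta] by the choice of [m]. *)
  rewrite -(cvg_lim _ (nondecreasing_cvg_mu _ _ _))//; last 2 first.
  - exact: bigcupT_measurable.
  - move=> k l kl; apply/subsetPset => om; rewrite /A/= => ek.
    exact: stopped_frozen kl.
  apply: lime_le.
    by apply: ereal_nondecreasing_is_cvgn => k l kl; apply: le_measure; rewrite ?inE// =>
      om; rewrite /A/= => ek; exact: stopped_frozen kl.
  apply: nearW => k /=.
  have : ((e ^+ 2)%:E * P (A e m k) <= (e ^+ 2)%:E * eta%:E)%E.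
    by rewrite -EFinM; apply: (le_trans (PA e m k e0)); rewrite lee_fin.
  by rewrite lee_pmul2l// lte_fin.
exists (\bigcup_j N (j.+1%:R^-1)); split.
- exact: bigcupT_measurable.
- apply/negligibleP; first exact: bigcupT_measurable.
  by apply: negligible_bigcup => j; apply/negligibleP => //; exact: N0.
- move=> om ncvg; apply: contrapT => nN; apply: ncvg.
  apply: cauchy_cvg; apply: cauchy_exP => e /= e0.
  have [j je] : exists j : nat, j.+1%:R^-1 < e.
    have [j _ je] := near_infty_natSinv_lt (PosNum e0).
    by exists j; exact: (je j (leqnn j)).
  have : ~ N (j.+1%:R^-1) om by move=> Nom; apply: nN; exists j.
  move=> /existsNP[m /not_implyP[_ nA]].
  have small k : `|stopped j.+1%:R^-1 a (X^~ om) m k| < j.+1%:R^-1.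
    by rewrite ltNge; apply/negP => ek; apply: nA; exists k.
  exists (\sum_(0 <= t < m) a t * X t om).
  exists m => // n /= mn; rewrite -ball_normE /= distrC.
  rewrite (big_cat_nat (leq0n m) mn)/= addrAC subrr add0r.
  apply: lt_trans je; have := small (n - m)%N; rewrite stoppedE//.
  have -> : \sum_(m <= t < n) a t * X t om =
      \sum_(0 <= i < n - m) a (m + i)%N * X (m + i)%N om.
    rewrite -{1}[m]add0n big_addn.
    by apply: eq_bigr => i _; rewrite addnC.
  by [].
Qed.

End WeightedIndependentSums.

(** * Almost sure regularity of one noise entry *)

Lemma measurable_coord (R : realType) (d : nat) (j : 'I_d) :
  measurable_fun setT (fun v : borel_rV R d => (v : 'rV[R]_d) 0 j).
Proof.
apply: (measurability _ (RGenOpens.measurableE R)) => _ [B oB <-].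
rewrite setTI.
have oB' : open B by case: oB => [x [y ->]]; exact: interval_open.
apply: (@sub_sigma_algebra _ setT (@open 'rV[R]_d)).
apply: (@open_comp _ _ (fun v : 'rV[R]_d => v 0 j)) => // v _.
exact: coord_continuous.
Qed.

Lemma ae_noise_regular (dO : measure_display) (Omega : measurableType dO)
    (R : realType) (P : probability Omega R) (d : nat)
    (W : nat -> {RV P >-> borel_rV R d}) (a b : nat -> R) (j : 'I_d)
    (X := fun t om => (W t om : 'rV[R]_d) 0 j) :
    mutually_independent P (fun t => W t) ->
    (forall t, 'E_P[X t] = 0)%E -> (forall t, 'V_P[X t] = 1)%E ->
    bounded_sums (fun t => a t ^+ 2) -> (forall t, 0 <= b t <= 1) ->
  {ae P, forall om, [/\ bounded_sums (fun t => (a t * X t om) ^+ 2),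
    bounded_sums (fun t => b t.+1 * lowpass b a (X^~ om) t ^+ 2) &
    cvgn (fun N => \sum_(0 <= t < N) a t * X t om)]}.
Proof.
move=> indep EX VX a2 b01.
have mX t : measurable_fun setT (X t).
  exact: (measurableT_comp (measurable_coord j)).
have indepX : mutually_independent P X.
  move=> s A us mA; apply: (indep s (fun i => [set v : 'rV[R]_d | A i (v 0 j)])) => // i.
  by have := @measurable_coord R d j measurableT (A i) (mA i); rewrite setTI.
have X0 t : (\int[P]_om (X t om)%:E = 0)%E by have := EX t; rewrite expectation.unlock.
have X1 t : (\int[P]_om (X t om ^+ 2)%:E = 1)%E.
  have := VX t; rewrite /variance covariance.unlock EX/= expectation.unlock => <-.
  apply: eq_integral => om _.
  by rewrite mulrfctE /= subr0 expr2.
have h1 := ae_bounded_sums_sqr mX X1 a2.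
have h2 := ae_bounded_sums_lowpass mX indepX X0 X1 a2 b01.
have h3 := ae_cvg_weighted_sum mX indepX X0 X1 a2.
by apply: filterS3 h1 h2 h3 => om; split.
Qed.

(** * Consensus *)

Section Consensus.
Variables (R : realType) (n S : nat).
Implicit Types (E : nat -> rel 'I_n).

(** A path from [i] to [j] must cross out of [A], and the crossing arc occurs in one of the [S]
    graphs of the window. *)
Lemma strongly_connected_exit E (A : {set 'I_n}) (i j : 'I_n) (t : nat) :
    S_strongly_connected S E -> i \in A -> j \notin A ->
  exists s : 'I_S, exists p, exists q, [/\ p \in A, q \notin A & E (t + s)%N p q].
Proof.
move=> conn iA jA; have /connectP[p + jl] := conn t i j.
elim: p i iA jl => [|k p ih] i iA /= jl.
  by move=> _; rewrite jl iA in jA.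
case/andP => /existsP[s ik] kp.
have [kA|kA] := boolP (k \in A); first exact: (ih k).
by exists s, i, k.
Qed.

(** Let [A k] be the nodes that the initial value at [j] has reached with a factor of at least
    [g ^+ k]. Every node is its own neighbour, so [A] never shrinks, and while it is proper an arc
    leaving it adds a node within [S] steps. After [n] windows it contains every node. *)
Lemma lower_propagation E (g : R) (u : 'I_n -> nat -> R) (i j : 'I_n) :
    S_strongly_connected S E -> 0 <= g ->
    (forall t i j, neighbor (E t) j i -> g * u j t <= u i t.+1) ->
  g ^+ (n * S) * u j 0%N <= u i (n * S)%N.
Proof.
move=> conn g0 step.
pose A k : {set 'I_n} := [set i | g ^+ k * u j 0%N <= u i k]%SET.
have Astep k p q : p \in A k -> neighbor (E k) p q -> q \in A k.+1.
  rewrite !finset.inE => pk pq; apply: le_trans (step _ _ _ pq).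
  by rewrite exprS -mulrA ler_wpM2l.
have Amono k l : (k <= l)%N -> A k \subset A l.
  elim: l => [|l ih]; first by rewrite leqn0 => /eqP ->.
  rewrite leq_eqVlt => /orP[/eqP -> //|/ih kl].
  apply: (fintype.subset_trans kl); apply/fintype.subsetP => p pl.
  by apply: Astep pl _; rewrite /neighbor eqxx.
have jA0 : j \in A 0%N by rewrite finset.inE expr0 mul1r.
have Agrow k : (k < #|A (k * S)%N|)%N || (A (k * S)%N == [set: 'I_n]%SET).
  elim: k => [|k /orP[ih|/eqP ih]].
  - by apply/orP; left; apply/card_gt0P; exists j.
  - have [full|] := eqVneq (A (k * S)%N) [set: 'I_n]%SET.
      apply/orP; right; rewrite finset.eqEsubset finset.subsetT -full.
      by apply: Amono; rewrite leq_mul2r leqnSn orbT.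
    move=> nfull; have [q qA] : exists q, q \notin A (k * S)%N.
      apply/existsP; rewrite -negb_forall; apply: contraNN nfull => /forallP h.
      by apply/eqP/setP => q; rewrite finset.in_setT h.
    have jk : j \in A (k * S)%N by apply: fintype.subsetP jA0; exact: Amono.
    have [s [p [r [pA rA pr]]]] := strongly_connected_exit (k * S) conn jk qA.
    apply/orP; left; apply: (leq_ltn_trans ih); apply: proper_card.
    apply/fintype.properP; split; first by apply: Amono; rewrite leq_mul2r leqnSn orbT.
    exists r => //; have : r \in A (k * S + s).+1.
      apply: (Astep _ p); last by rewrite /neighbor pr orbT.
      by apply: fintype.subsetP pA; apply: Amono; rewrite leq_addr.
    apply: fintype.subsetP; apply: Amono.
    by rewrite mulSn addnC ltn_add2r.
  - apply/orP; right; rewrite finset.eqEsubset finset.subsetT -ih.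
    by apply: Amono; rewrite leq_mul2r leqnSn orbT.
have : i \in A (n * S)%N; last by rewrite finset.inE.
(* At [k = n] the first alternative would need more than [n] nodes. *)
case/orP: (Agrow n) => [|/eqP ->]; last by rewrite finset.in_setT.
by rewrite ltnNge -[X in (_ <= X)%N]card_ord max_card.
Qed.

(** A sum of nonnegative terms dominates each of them, which yields the arcwise bound of
    [lower_propagation]. *)
Lemma stochastic_propagation E (g : R) (Q : nat -> 'I_n -> 'I_n -> R)
    (u : 'I_n -> nat -> R) :
    S_strongly_connected S E -> 0 <= g ->
    (forall t i j, 0 <= Q t i j) ->
    (forall t i j, neighbor (E t) j i -> g <= Q t i j) ->
    (forall i, 0 <= u i 0%N) ->
    (forall t i, \sum_j Q t i j * u j t <= u i t.+1) ->
  (forall i t, 0 <= u i t) /\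
  (forall i j, g ^+ (n * S) * u j 0%N <= u i (n * S)%N).
Proof.
move=> conn g0 Q0 Qg u0 ustep.
have u_ge0 i t : 0 <= u i t.
  elim: t i => // t ih i; apply: le_trans (ustep t i).
  by apply: sumr_ge0 => j _; rewrite mulr_ge0.
split=> // i j; apply: lower_propagation conn g0 _ => t p q qp.
apply: le_trans (ustep t p); rewrite (bigD1 q)//=.
apply: ler_wpDr; first by apply: sumr_ge0 => r _; rewrite mulr_ge0.
by rewrite ler_wpM2r// Qg.
Qed.

(** The base value 0 of the maximum does not change it when [n > 0], since the diagonal pairs
    contribute 0. *)
Definition spread (s : 'I_n -> R) : R :=
  \big[Num.max/0]_(p : 'I_n * 'I_n) (s p.1 - s p.2).

Lemma spread_ge (s : 'I_n -> R) i j : s i - s j <= spread s.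
Proof. exact: (le_bigmax _ (fun p : 'I_n * 'I_n => s p.1 - s p.2) (i, j)). Qed.

Lemma spread_ge0 (s : 'I_n -> R) : 0 <= spread s.
Proof. exact: bigmax_ge_id. Qed.

Lemma spread_le (s : 'I_n -> R) (c : R) : 0 <= c ->
  (forall i j, s i - s j <= c) -> spread s <= c.
Proof. by move=> c0 sc; apply: bigmax_le => // -[i j] _; exact: sc. Qed.

(** Let H be the accumulated error. The gaps [max + H - s i] and [s i - min + H], with the initial
    extremes, stay nonnegative and dominate their averages. At the minimiser the initial upper gap
    is the full spread, and a fraction [g ^+ (n * S)] of it reaches every node; adding the two gaps
    gives the bound. *)
Lemma spread_contraction E (g : R) (Q : nat -> 'I_n -> 'I_n -> R)
    (s : 'I_n -> nat -> R) (h : nat -> R) :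
    (0 < n)%N -> S_strongly_connected S E -> 0 <= g <= 1 ->
    (forall t i j, 0 <= Q t i j) -> (forall t i, \sum_j Q t i j = 1) ->
    (forall t i j, neighbor (E t) j i -> g <= Q t i j) ->
    (forall t i, `|s i t.+1 - \sum_j Q t i j * s j t| <= h t) ->
  spread (s^~ (n * S)%N) <=
  (1 - g ^+ (n * S)) * spread (s^~ 0%N) + 2 * \sum_(0 <= t < n * S) h t.
Proof.
move=> n0 conn /andP[g0 g1] Q0 Q1 Qg sh.
have h0 t : 0 <= h t by apply: le_trans (sh t (Ordinal n0)).
have H0 N : 0 <= \sum_(0 <= t < N) h t by apply: sumr_ge0.
have convex c t i (v : 'I_n -> R) :
    \sum_j Q t i j * (c + v j) = c + \sum_j Q t i j * v j.
  under eq_bigr do rewrite mulrDr.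
  by rewrite big_split -mulr_suml Q1 mul1r.
have convexN c t i (v : 'I_n -> R) :
    \sum_j Q t i j * (c - v j) = c - \sum_j Q t i j * v j.
  by rewrite convex -sumrN; congr (_ + _); apply: eq_bigr => j _; rewrite mulrN.
have [i0 _ maxi0] := @arg_maxP _ _ _ (Ordinal n0) xpredT (s^~ 0%N) isT.
have [j0 _ minj0] := @arg_minP _ _ _ (Ordinal n0) xpredT (s^~ 0%N) isT.
have [up_ge0 up] := @stochastic_propagation E g Q
  (fun i t => s i0 0%N + \sum_(0 <= k < t) h k + - s i t) conn g0 Q0 Qg
  ltac:(by move=> i; rewrite /= big_geq// addr0 subr_ge0; exact: maxi0)
  ltac:(move=> t i; rewrite /= convexN big_nat_recr//=;
    have := sh t i; rewrite ler_norml => /andP[]; lra).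
have [lo_ge0 _] := @stochastic_propagation E g Q
  (fun i t => (- s j0 0%N + \sum_(0 <= k < t) h k) + s i t) conn g0 Q0 Qg
  ltac:(by move=> i; rewrite /= big_geq// addr0 addrC subr_ge0; exact: minj0)
  ltac:(move=> t i; rewrite /= convex big_nat_recr//=;
    have := sh t i; rewrite ler_norml => /andP[]; lra).
have gT1 : g ^+ (n * S) <= 1 by rewrite exprn_ile1.
apply: spread_le.
  by rewrite addr_ge0 ?mulr_ge0 ?subr_ge0 ?spread_ge0.
move=> i j; have := up i j0; rewrite /= [X in _ + X - _]big_geq// addr0.
have := lo_ge0 j (n * S)%N.
have : (1 - g ^+ (n * S)) * (s i0 0%N - s j0 0%N) <=
       (1 - g ^+ (n * S)) * spread (s^~ 0%N).
  by rewrite ler_wpM2l ?subr_ge0//; exact: (spread_ge (s^~ 0%N)).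
lra.
Qed.

End Consensus.

(** Convexity of the square with weights [r] and [1 - r] gives the same recursion for the squares,
    with error [h ^+ 2 / (1 - r)]. Summing over [t < N] bounds the sum by the first [T] squares,
    plus [r] times itself, plus a constant. *)
Lemma contraction_square_summable (R : realType) (T : nat) (r : R)
    (D h : nat -> R) :
    0 <= r < 1 -> (forall t, 0 <= D t) ->
    (forall t, D (t + T)%N <= r * D t + h t) ->
    bounded_sums (fun t => h t ^+ 2) ->
  bounded_sums (fun t => D t ^+ 2).
Proof.
move=> /andP[r0 r1] D0 Dh [C hC].
have r1' : 0 < 1 - r by rewrite subr_gt0.
exists ((\sum_(0 <= t < T) D t ^+ 2 + C / (1 - r)) / (1 - r)) => N.
rewrite ler_pdivlMr//.
have step t : D (t + T)%N ^+ 2 <= r * D t ^+ 2 + h t ^+ 2 / (1 - r).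
  pose k := h t / (1 - r).
  have kE : h t = (1 - r) * k by rewrite /k mulrC divfK// gt_eqF.
  have -> : h t ^+ 2 / (1 - r) = (1 - r) * k ^+ 2.
    by rewrite /k; field; rewrite gt_eqF.
  have h1 : D (t + T)%N <= r * D t + (1 - r) * k by rewrite -kE.
  have h2 : D (t + T)%N ^+ 2 <= (r * D t + (1 - r) * k) ^+ 2.
    by rewrite lerXn2r ?nnegrE// (le_trans _ h1).
  apply: (le_trans h2); rewrite -subr_ge0.
  have -> : r * D t ^+ 2 + (1 - r) * k ^+ 2 - (r * D t + (1 - r) * k) ^+ 2 =
      r * (1 - r) * (D t - k) ^+ 2 by ring.
  by rewrite mulr_ge0 ?sqr_ge0// mulr_ge0// ltW.
have : \sum_(0 <= t < N) D t ^+ 2 <= \sum_(0 <= t < N + T) D t ^+ 2.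
  rewrite (big_cat_nat (leq0n N) (leq_addr T N))/= lerDl.
  by apply: sumr_ge0 => t _; exact: sqr_ge0.
rewrite (big_cat_nat (leq0n T) (leq_addl N T))/=.
have -> : \sum_(T <= t < N + T) D t ^+ 2 = \sum_(0 <= t < N) D (t + T)%N ^+ 2.
  by rewrite -{1}[T]add0n big_addn addnK.
have : \sum_(0 <= t < N) D (t + T)%N ^+ 2 <=
    r * \sum_(0 <= t < N) D t ^+ 2 + C / (1 - r).
  apply: (@le_trans _ _ (\sum_(0 <= t < N) (r * D t ^+ 2 + h t ^+ 2 / (1 - r)))).
    by apply: ler_sum => t _.
  by rewrite big_split/= -mulr_sumr -mulr_suml lerD2l ler_wpM2r// invr_ge0 ltW.
lra.
Qed.

(** * Sup norm, Euclidean norm and square-summable sequences *)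

Section RowVectorNorms.
Variables (R : realType) (d : nat).
Implicit Types v : 'rV[R]_d.

Lemma coord_le_norm v j : `|v 0 j| <= `|v|.
Proof.
rewrite [leRHS]mx_normrE.
exact: (le_bigmax _ (fun p : 'I_1 * 'I_d => `|v p.1 p.2|) (0, j)).
Qed.

Lemma norm_le_coord v (c : R) : 0 <= c -> (forall j, `|v 0 j| <= c) -> `|v| <= c.
Proof.
move=> c0 vc; rewrite [leLHS]mx_normrE; apply: bigmax_le => // -[i j] _ /=.
by rewrite ord1.
Qed.

Lemma enorm_ge0 v : 0 <= enorm v.
Proof. exact: sqrtr_ge0. Qed.

Lemma coord_le_enorm v j : `|v 0 j| <= enorm v.
Proof.
rewrite -sqrtr_sqr ler_wsqrtr// (bigD1 j)//= lerDl.
by apply: sumr_ge0 => k _; exact: sqr_ge0.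
Qed.

Lemma norm_le_enorm v : `|v| <= enorm v.
Proof. by apply: norm_le_coord => [|j]; [exact: enorm_ge0|exact: coord_le_enorm]. Qed.

Lemma enorm_le_norm v : enorm v <= d%:R * `|v|.
Proof.
have c0 : 0 <= d%:R * `|v| by rewrite mulr_ge0.
rewrite -[leRHS]ger0_norm// -sqrtr_sqr ler_wsqrtr//.
apply: (@le_trans _ _ (\sum_(j < d) `|v| ^+ 2)).
  apply: ler_sum => j _; rewrite -(real_normK (num_real (v 0 j))).
  by rewrite lerXn2r ?nnegrE// coord_le_norm.
rewrite sumr_const card_ord exprMn -[leLHS]mulr_natl ler_wpM2r ?sqr_ge0//.
by rewrite -natrX ler_nat; case: (d) => // k; rewrite -mulnn leq_pmulr.
Qed.

End RowVectorNorms.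

Section SquareSummable.
Variable R : realType.
Implicit Types u v : nat -> R.

Lemma square_summableD u v : bounded_sums (fun t => u t ^+ 2) ->
  bounded_sums (fun t => v t ^+ 2) -> bounded_sums (fun t => (u t + v t) ^+ 2).
Proof.
move=> bu bv; have := bounded_sumsZ (ler0n R 2) (bounded_sumsD bu bv).
by apply: bounded_sums_le => t; have := sqr_ge0 (u t - v t); nra.
Qed.

Lemma square_summableZ (c : R) u : bounded_sums (fun t => u t ^+ 2) ->
  bounded_sums (fun t => (c * u t) ^+ 2).
Proof.
move=> bu; have := bounded_sumsZ (sqr_ge0 c) bu.
by apply: bounded_sums_le => t; rewrite exprMn.
Qed.

Lemma square_summable_sum (I : Type) (s : seq I) (u : I -> nat -> R) :
  (forall i, bounded_sums (fun t => u i t ^+ 2)) ->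
  bounded_sums (fun t => (\sum_(i <- s) u i t) ^+ 2).
Proof.
move=> bu; elim: s => [|i s ih].
  by exists 0 => N; rewrite big1// => t _; rewrite big_nil expr0n.
have := square_summableD (bu i) ih.
by apply: bounded_sums_le => t; rewrite big_cons.
Qed.

End SquareSummable.

(** The average with weights [q] exceeds no entry by more than the spread, hence no other average
    either; exchanging [p] and [q] gives the other side. *)
Lemma convex_gap (R : realType) (n : nat) (p q s : 'I_n -> R) :
    (forall i, 0 <= p i) -> (forall i, 0 <= q i) ->
    \sum_i p i = 1 -> \sum_i q i = 1 ->
  `|\sum_i q i * s i - \sum_i p i * s i| <= spread s.
Proof.
have half (p' q' : 'I_n -> R) : (forall i, 0 <= p' i) -> (forall i, 0 <= q' i) ->
    \sum_i p' i = 1 -> \sum_i q' i = 1 ->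
    \sum_i q' i * s i - \sum_i p' i * s i <= spread s.
  move=> p0 q0 p1 q1; rewrite lerBlDr.
  have qs i : \sum_j q' j * s j <= spread s + s i.
    apply: (@le_trans _ _ (\sum_j q' j * (spread s + s i))).
      by apply: ler_sum => j _; rewrite ler_wpM2l// -lerBlDr spread_ge.
    by rewrite -mulr_suml q1 mul1r.
  rewrite -[leLHS]mul1r -[in leLHS]p1 mulr_suml.
  apply: (@le_trans _ _ (\sum_i p' i * (spread s + s i))).
    by apply: ler_sum => i _; rewrite ler_wpM2l.
  under eq_bigr do rewrite mulrDr.
  by rewrite big_split/= -mulr_suml p1 mul1r.
move=> p0 q0 p1 q1; rewrite ler_norml half// andbT lerNl opprB.
exact: half.
Qed.

(** * Push-sum as an averaging of ratios *)

Section PushSum.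
Variables (R : realType) (n d S : nat) (E : nat -> rel 'I_n) (a : nat -> R).
Variables (f : 'I_n -> 'rV[R]_d -> 'rV[R]_d) (W : 'I_n -> nat -> 'rV[R]_d).
Variables (x0 : 'I_n -> 'rV[R]_d) (x w z : 'I_n -> nat -> 'rV[R]_d).
Variable y : 'I_n -> nat -> R.
Hypothesis PS : push_sum E a f W x0 x w z y.
Hypothesis n_gt0 : (0 < n)%N.
Hypothesis conn : S_strongly_connected S E.

Lemma outdeg_gt0 t i : (0 < outdeg (E t) i)%N.
Proof. by apply/card_gt0P; exists i; rewrite unfold_in /= /neighbor eqxx. Qed.

Lemma outdeg_le t i : (outdeg (E t) i <= n)%N.
Proof. by rewrite -[X in (_ <= X)%N]card_ord max_card. Qed.

(** Node [j] hands out [outdeg] equal shares of [v j], so nothing is lost. The module [V] is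
    arbitrary in order to cover the weights [y] as well as the states [x]. *)
Lemma push_mass (V : lmodType R) (v : 'I_n -> V) t :
  \sum_i \sum_(j < n | neighbor (E t) j i) (outdeg (E t) j)%:R^-1 *: v j =
  \sum_j v j.
Proof.
rewrite (exchange_big_dep xpredT)//=; apply: eq_bigr => j _.
rewrite sumr_const -scaler_nat scalerA mulfV ?scale1r// pnatr_eq0 -lt0n.
exact: outdeg_gt0.
Qed.

Lemma push_sum_yE i t : y i t.+1 =
  \sum_(j < n | neighbor (E t) j i) (outdeg (E t) j)%:R^-1 * y j t.
Proof. by rewrite (push_sum_y PS); apply: eq_bigr => j _; rewrite mulrC. Qed.

Lemma sum_y t : \sum_i y i t = n%:R.
Proof.
elim: t => [|t <-].
  under eq_bigr do rewrite (push_sum_y0 PS).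
  by rewrite sumr_const card_ord.
under eq_bigr do rewrite push_sum_yE.
exact: (push_mass (V := R^o)).
Qed.

Let g : R := n%:R^-1.
Let g0 : 0 < g. Proof. by rewrite invr_gt0 ltr0n. Qed.
Let g1 : g <= 1.
Proof. by rewrite invf_le1 ?ltr0n// ler1n. Qed.

Let deg_ge t i : g <= (outdeg (E t) i)%:R^-1.
Proof. by rewrite lef_pV2 ?posrE ?ltr0n ?outdeg_gt0// ler_nat outdeg_le. Qed.

Lemma y_ge0 i t : 0 <= y i t.
Proof.
elim: t i => [|t ih] i; first by rewrite (push_sum_y0 PS).
by rewrite push_sum_yE; apply: sumr_ge0 => j _; rewrite mulr_ge0 ?invr_ge0.
Qed.

Let y_step t i j : neighbor (E t) j i -> g * y j t <= y i t.+1.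
Proof.
move=> ji; rewrite push_sum_yE (bigD1 j)//=; apply: ler_wpDr.
  by apply: sumr_ge0 => k _; rewrite mulr_ge0 ?invr_ge0 ?y_ge0.
by rewrite ler_wpM2r ?y_ge0.
Qed.

Definition y_floor : R := n%:R^-1 ^+ (n * S).

Lemma y_floor_gt0 : 0 < y_floor. Proof. by rewrite exprn_gt0. Qed.

(** Before time [n * S] the share that a node keeps for itself suffices. Later, the weight of every
    node [n * S] steps earlier has reached [i] up to the factor [y_floor]; averaging over these
    nodes, whose weights sum to [n], gives the bound. *)
Lemma y_ge i t : y_floor <= y i t.
Proof.
have [tT|Tt] := ltnP t (n * S).
  have : g ^+ t <= y i t.
    elim: (t) i => [|s ih] i; first by rewrite (push_sum_y0 PS) expr0.
    rewrite exprS; apply: le_trans (_ : g * y i s <= _).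
      by rewrite ler_wpM2l// ltW.
    by apply: y_step; rewrite /neighbor eqxx.
  by apply: le_trans; apply: (ler_wiXn2l (ltW g0) g1); exact: ltnW.
(* The process is restarted [n * S] steps before [t]; the shifted graph sequence is again strongly
   connected. *)
have low j : g ^+ (n * S) * y j (t - n * S)%N <= y i t.
  have := @lower_propagation R n S (fun s => E (t - n * S + s)%N) g
    (fun i s => y i (t - n * S + s)%N) i j.
  rewrite addn0 subnK//; apply => //; last 2 first.
  - exact: ltW.
  - by move=> s p q; rewrite addnS; exact: y_step.
  move=> s p q; have := conn (t - n * S + s)%N p q.
  by under eq_connect => p' q' do under eq_existsb => s' do rewrite -addnA.
have : \sum_(j < n) g ^+ (n * S) * y j (t - n * S)%N <= \sum_(j < n) y i t.
  by apply: ler_sum => j _.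
rewrite -mulr_sumr sum_y sumr_const card_ord -[leRHS]mulr_natr.
by rewrite ler_pM2r ?ltr0n.
Qed.

Lemma y_le i t : y i t <= n%:R.
Proof.
rewrite -(sum_y t) (bigD1 i)//= lerDl.
by apply: sumr_ge0 => k _; exact: y_ge0.
Qed.

Let y_gt0 i t : 0 < y i t.
Proof. exact: lt_le_trans y_floor_gt0 (y_ge i t). Qed.

(** Mixing preserves the total by [push_mass], so only the perturbations move the average. *)
Lemma average_push_sum t : average (x^~ t.+1) = average (x^~ t) -
  a t.+1 *: average (fun i => f i (z i t.+1)) - a t.+1 *: average (W^~ t.+1).
Proof.
rewrite /average.
under eq_bigr do rewrite (push_sum_x PS) (push_sum_w PS).
rewrite !sumrB push_mass -!scaler_sumr !scalerBr.
by rewrite !scalerA ![_ * a _]mulrC.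
Qed.

(** Dividing by the weights turns the column-stochastic mixing of [x] and [y] into a row-stochastic
    mixing of the ratios [x j t / y j t], with this matrix. *)
Let Q t i j : R :=
  if neighbor (E t) j i then (outdeg (E t) j)%:R^-1 * y j t / y i t.+1 else 0.

Let Q_ge0 t i j : 0 <= Q t i j.
Proof.
by rewrite /Q; case: ifP => // _; rewrite !mulr_ge0 ?invr_ge0 ?y_ge0.
Qed.

Let Q_sum t i : \sum_j Q t i j = 1.
Proof.
rewrite /Q -big_mkcond/= -mulr_suml -push_sum_yE mulfV// gt_eqF//.
Qed.

(** Along an arc the share is at least [g], the weight of the sender at least [y_floor] and the
    weight of the receiver at most [n]. *)
Let q : R := g * y_floor / n%:R.

Let q01 : 0 < q <= 1.
Proof.
have yf1 : y_floor <= 1 by rewrite exprn_ile1// ltW.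
rewrite /q !mulr_gt0 ?y_floor_gt0//= ler_pdivrMr ?ltr0n// mul1r.
apply: (@le_trans _ _ 1); last by rewrite ler1n.
by rewrite mulr_ile1// ltW// y_floor_gt0.
Qed.

Let Q_ge t i j : neighbor (E t) j i -> q <= Q t i j.
Proof.
move=> ji; rewrite /Q ji /q.
apply: ler_pM.
- by rewrite mulr_ge0// ltW// y_floor_gt0.
- by rewrite invr_ge0.
- by apply: ler_pM; rewrite ?y_ge ?deg_ge// ltW// y_floor_gt0.
- by rewrite lef_pV2 ?posrE ?ltr0n ?y_le.
Qed.

Let zE t i k : z i t.+1 0 k = \sum_j Q t i j * (x j t 0 k / y j t).
Proof.
rewrite (push_sum_z PS) mxE (push_sum_w PS) summxE mulr_sumr big_mkcond/=.
apply: eq_bigr => j _; rewrite /Q; case: ifP => _; last by rewrite mul0r.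
by rewrite mxE; field; rewrite !gt_eqF ?ltr0n ?outdeg_gt0 ?y_gt0.
Qed.

Let xbarE t k : average (x^~ t) 0 k =
  \sum_j (n%:R^-1 * y j t) * (x j t 0 k / y j t).
Proof.
rewrite /average mxE summxE mulr_sumr; apply: eq_bigr => j _.
by field; rewrite !gt_eqF ?ltr0n ?y_gt0.
Qed.

(** Times [t.+1] and [t] are compared because [z i t.+1] and the average at [t] are both mixtures of
    the ratios at [t]. Each step perturbs the ratios by a square-summable amount, so the contraction
    makes their spread square summable in every coordinate. *)
Lemma push_sum_consensus (K : R) :
    0 <= K -> (forall i v, enorm (f i v) <= K) -> (forall t, 0 <= a t) ->
    bounded_sums (fun t => a t ^+ 2) ->
    (forall i k, bounded_sums (fun t => (a t * W i t 0 k) ^+ 2)) ->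
  exists c : nat -> R, [/\ forall t, 0 <= c t, bounded_sums (fun t => c t ^+ 2) &
    forall i t, `|z i t.+1 - average (x^~ t)| <= c t].
Proof.
move=> K0 fK a0 a2 aW2.
pose s k i t := x i t 0 k / y i t.
pose D k t := spread (s k ^~ t).
(* Summing over all nodes makes one error bound valid for each of them; dividing by the weights
   costs the factor [y_floor^-1]. *)
pose h k t := y_floor^-1 * \sum_i (K * a t.+1 + `|a t.+1 * W i t.+1 0 k|).
have h2 k : bounded_sums (fun t => h k t ^+ 2).
  apply: square_summableZ; apply: square_summable_sum => i.
  apply: square_summableD.
    apply: square_summableZ.
    by apply: (@bounded_sumsS _ (fun t => a t ^+ 2)) => // t; exact: sqr_ge0.
  have := aW2 i k => /(bounded_sumsS (fun t => sqr_ge0 _)).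
  by apply: bounded_sums_le => t; rewrite real_normK ?num_real.
have yi i t : (y i t)^-1 <= y_floor^-1.
  by rewrite lef_pV2 ?posrE ?y_gt0 ?y_floor_gt0 ?y_ge.
(* The new ratio is [z i t.+1], an exact average of the old ratios, minus the perturbation divided
   by the weight. *)
have sh k t i : `|s k i t.+1 - \sum_j Q t i j * s k j t| <= h k t.
  rewrite -zE (push_sum_z PS) /s (push_sum_x PS) !mxE.
  have -> : (w i t.+1 0 k - a t.+1 * f i (z i t.+1) 0 k - a t.+1 * W i t.+1 0 k) /
      y i t.+1 - (y i t.+1)^-1 * w i t.+1 0 k =
      (y i t.+1)^-1 * - (a t.+1 * f i (z i t.+1) 0 k + a t.+1 * W i t.+1 0 k).
    by ring.
  rewrite normrM normrN ger0_norm ?invr_ge0 ?y_ge0// ler_pM ?invr_ge0 ?y_ge0//.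
  apply: (@le_trans _ _ (K * a t.+1 + `|a t.+1 * W i t.+1 0 k|)).
    rewrite (le_trans (ler_normD _ _))// lerD2r normrM ger0_norm// mulrC.
    by rewrite ler_wpM2r// (le_trans (coord_le_enorm _ _)).
  rewrite (bigD1 i)//= lerDl; apply: sumr_ge0 => j _.
  by rewrite addr_ge0 ?mulr_ge0.
have /andP[q0 q1] := q01.
have DT k t : D k (t + n * S)%N <=
    (1 - q ^+ (n * S)) * D k t + 2 * \sum_(0 <= l < n * S) h k (t + l)%N.
  have := @spread_contraction R n S (fun l => E (t + l)%N) q
    (fun l => Q (t + l)%N) (fun i l => s k i (t + l)%N) (fun l => h k (t + l)%N).
  rewrite /D addn0; apply => //.
  - move=> l i j; have := conn (t + l)%N i j.
    by under eq_connect => p' q' do under eq_existsb => s' do rewrite -addnA.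
  - by rewrite ltW.
  - by move=> l i j; exact: Q_ge.
  - by move=> l i; rewrite addnS; exact: sh.
have D2 k : bounded_sums (fun t => D k t ^+ 2).
  apply: (contraction_square_summable (T := (n * S)%N) (r := 1 - q ^+ (n * S)) _ _ (DT k)).
  - apply/andP; split; first by rewrite subr_ge0 exprn_ile1// ltW.
    by rewrite gtrBl exprn_gt0.
  - by move=> t; exact: spread_ge0.
  - apply: square_summableZ; apply: square_summable_sum => l.
    have := @bounded_sums_addn _ (fun t => h k t ^+ 2) l (fun t => sqr_ge0 _) (h2 k).
    by [].
exists (fun t => \sum_k D k t); split.
- by move=> t; apply: sumr_ge0 => k _; exact: spread_ge0.
- exact: square_summable_sum.
- move=> i t; apply: norm_le_coord.
    by apply: sumr_ge0 => k _; exact: spread_ge0.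
  move=> k.
  apply: (@le_trans _ _ (D k t)); last first.
    by rewrite (bigD1 k)//= lerDl; apply: sumr_ge0 => l _; exact: spread_ge0.
  have -> : (z i t.+1 - average (x^~ t)) 0 k = z i t.+1 0 k - average (x^~ t) 0 k.
    by rewrite !mxE.
  (* The two convex combinations have weights [Q] and [y / n]. *)
  rewrite zE xbarE; apply: convex_gap => //.
  + by move=> j; rewrite mulr_ge0 ?invr_ge0 ?y_ge0.
  + by rewrite -mulr_sumr sum_y mulVf// pnatr_eq0 -lt0n.
Qed.

End PushSum.

(** * Recursions driven by the step sizes *)

Section RealSequences.
Variable R : realType.
Implicit Types u v a b g : nat -> R.

Lemma bounded_sums_eventually u v k : (forall t, 0 <= u t) ->
  (forall t, (k <= t)%N -> u t <= v t) -> (forall t, 0 <= v t) ->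
  bounded_sums v -> bounded_sums u.
Proof.
move=> u0 uv v0 [C vC]; exists (\sum_(0 <= t < k) u t + C) => N.
have uN : \sum_(0 <= t < N) u t <= \sum_(0 <= t < k + N) u t.
  rewrite (big_cat_nat (leq0n N) (leq_addl k N))/= lerDl.
  by apply: sumr_ge0.
apply: (le_trans uN); rewrite (big_cat_nat (leq0n k) (leq_addr N k))/= lerD2l.
apply: le_trans (vC (k + N)%N).
rewrite [leRHS](big_cat_nat (leq0n k) (leq_addr N k))/=.
apply: ler_wpDl; first exact: sumr_ge0.
by apply: ler_sum_nat => t /andP[kt _]; exact: uv.
Qed.

(* The cubes of [g] have summable increments, hence converge; a positive limit
   would make [a] summable. *)
Lemma slow_square_summable_cvg0 g a (M : R) :
    (forall t, 0 <= g t) -> (forall t, 0 <= a t) ->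
    (forall t, `|g t.+1 - g t| <= M * a t) ->
    bounded_sums (fun t => a t * g t ^+ 2) ->
    bounded_sums (fun t => a t ^+ 2) -> ~ bounded_sums a ->
  g t @[t --> \oo] --> 0.
Proof.
move=> g0 a0 gM bag ba2 nba.
have [A a2A] := ba2.
have A0 : 0 <= A by have := a2A 0%N; rewrite big_geq.
(* Boundedness of [a] lets the error term in [a ^+ 3] be absorbed by one in [a ^+ 2]. *)
have aA t : a t <= 1 + A.
  have := a2A t.+1; rewrite big_nat_recr//=.
  have : 0 <= \sum_(0 <= i < t) a i ^+ 2 by apply: sumr_ge0 => i _; exact: sqr_ge0.
  have := sqr_ge0 (a t - 1); nra.
(* A difference of cubes is [(p - q) * (p ^+ 2 + p * q + q ^+ 2)], and [p <= q + |M| * a] bounds the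
   second factor by [6 * q ^+ 2 + 6 * (|M| * a) ^+ 2]. *)
pose u t := `|M| * (6 * (a t * g t ^+ 2) + 6 * (`|M| ^+ 2 * (1 + A)) * a t ^+ 2).
have u0 t : 0 <= u t.
  apply: mulr_ge0 => //; apply: addr_ge0; apply: mulr_ge0 => //.
  - by rewrite mulr_ge0// sqr_ge0.
  - by rewrite !mulr_ge0 ?sqr_ge0// addr_ge0.
  - exact: sqr_ge0.
have bu : bounded_sums u.
  apply: bounded_sumsZ => //; apply: bounded_sumsD; apply: bounded_sumsZ => //.
  by rewrite !mulr_ge0 ?sqr_ge0// addr_ge0.
have cube t : `|g t.+1 ^+ 3 - g t ^+ 3| <= u t.
  have -> : g t.+1 ^+ 3 - g t ^+ 3 =
    (g t.+1 - g t) * (g t.+1 ^+ 2 + g t.+1 * g t + g t ^+ 2) by ring.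
  have gt1 : g t.+1 <= g t + `|M| * a t.
    have := gM t; rewrite ler_norml => /andP[_]; have := ler_norm M; have := a0 t.
    move: (g t.+1) (g t) (a t) `|M| => p q r s; nra.
  rewrite normrM.
  have q0 : 0 <= g t.+1 ^+ 2 + g t.+1 * g t + g t ^+ 2.
    by rewrite !addr_ge0 ?sqr_ge0// mulr_ge0.
  rewrite (ger0_norm q0).
  have dM : `|g t.+1 - g t| <= `|M| * a t.
    by apply: (le_trans (gM t)); rewrite ler_wpM2r// ler_norm.
  have q1 : g t.+1 ^+ 2 + g t.+1 * g t + g t ^+ 2 <=
      6 * g t ^+ 2 + 6 * (`|M| * a t) ^+ 2.
    have := g0 t; have := g0 t.+1; move: gt1.
    have : 0 <= `|M| * a t by rewrite mulr_ge0.
    move: (g t.+1) (g t) (`|M| * a t) => p q r; clear.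
    move=> r0 pqr p0 qq0.
    have := sqr_ge0 (q - r).
    have : p ^+ 2 <= (q + r) ^+ 2 by rewrite lerXn2r ?nnegrE// addr_ge0.
    have : p * q <= (q + r) * q by rewrite ler_wpM2r.
    nra.
  apply: (le_trans (ler_pM _ q0 dM q1)) => //.
  rewrite /u -[leLHS]mulrA ler_wpM2l// mulrDr exprMn.
  have -> : a t * (6 * g t ^+ 2) = 6 * (a t * g t ^+ 2) by ring.
  rewrite lerD2l.
  have -> : a t * (6 * (`|M| ^+ 2 * a t ^+ 2)) = (6 * `|M| ^+ 2 * a t ^+ 2) * a t by ring.
  have -> : 6 * (`|M| ^+ 2 * (1 + A)) * a t ^+ 2 = (6 * `|M| ^+ 2 * a t ^+ 2) * (1 + A) by ring.
  by rewrite ler_wpM2l// !mulr_ge0 ?sqr_ge0.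
(* Adding the accumulated variation makes the cubes nondecreasing, so that convergence only requires
   a bound. *)
pose G t := g t ^+ 3 + series u t.
have sS t : series u t.+1 = series u t + u t.
  by rewrite !seriesEnat/= big_nat_recr.
have [U uU] := bu.
have cG : cvgn G.
  apply: nondecreasing_is_cvgn.
    apply/nondecreasing_seqP => t; rewrite /G sS.
    by have := cube t; rewrite ler_norml => /andP[]; lra.
  exists (g 0%N ^+ 3 + U + U) => _ [t _ <-]; rewrite /G.
  have : series u t <= U by rewrite seriesEnat; exact: uU.
  have : g t ^+ 3 <= g 0%N ^+ 3 + series u t.
    elim: t => [|t ih]; first by rewrite seriesEnat/= big_geq// addr0.
    by rewrite sS; have := cube t; rewrite ler_norml => /andP[]; lra.
  lra.
have cu := bounded_sums_series u0 bu.
have c3 : g t ^+ 3 @[t --> \oo] --> limn G - limn (series u).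
  have -> : (fun t => g t ^+ 3) = G \- series u.
    by apply/funext => t; rewrite /G /= addrK.
  exact: cvgB.
set l := limn G - limn (series u) in c3.
have l0 : 0 <= l.
  rewrite -(cvg_lim _ c3)//; apply: limr_ge; first by apply/cvg_ex; exists l.
  by apply: nearW => t; rewrite exprn_ge0.
have {}l0 : l = 0.
  apply/eqP; rewrite eq_le l0 andbT leNgt; apply/negP => lpos.
  apply: nba.
  (* The cap at 1 gives [g t ^+ 3 <= g t] whenever [g t < c]; such values have cubes below [l / 2]
     and cannot occur once the cubes are close to [l]. *)
  pose c := Num.min 1 (l / 2).
  have c_gt0 : 0 < c by rewrite lt_min ltr01 divr_gt0.
  have [k _ kg] : \forall t \near \oo, c <= g t.
    have l2 : 0 < l / 2 by rewrite divr_gt0.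
    move/cvgrPdist_lt : c3 => /(_ _ l2); apply: filterS => t.
    rewrite ltr_norml => /andP[_ lt]; rewrite leNgt; apply/negP => gc.
    have c1 : c <= 1 by rewrite ge_min lexx.
    have cl : c <= l / 2 by rewrite ge_min lexx orbT.
    have : g t ^+ 3 <= g t.
      by rewrite exprS ler_piMr// exprn_ile1// ltW// (lt_le_trans gc).
    lra.
  have : bounded_sums (fun t => (c ^+ 2)^-1 * (a t * g t ^+ 2)).
    by apply: bounded_sumsZ => //; rewrite invr_ge0 sqr_ge0.
  apply: (bounded_sums_eventually (k := k)) => // [t kt|t]; last first.
    by rewrite mulr_ge0 ?invr_ge0 ?sqr_ge0// mulr_ge0// sqr_ge0.
  rewrite mulrCA ler_peMr// mulrC ler_pdivlMr ?exprn_gt0// mul1r.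
  by rewrite lerXn2r ?nnegrE ?(ltW c_gt0)//; exact: kg.
rewrite l0 in c3; apply/cvgrPdist_lt => e e0.
move/cvgrPdist_lt : c3 => /(_ (e ^+ 3)); rewrite exprn_gt0// => /(_ isT).
apply: filterS => t; rewrite !sub0r !normrN !ger0_norm ?exprn_ge0//.
by rewrite ltr_pXn2r ?nnegrE// ltW.
Qed.

(** Subtracting the deviation [N] of the partial sums from their limit leaves a sequence [u] that
    relaxes towards [- N] at rate [b]. As [N] tends to 0 and [b] is not summable, so does [u]. *)
Lemma lowpass_cvg0 a b (X : nat -> R) :
    (forall t, 0 <= b t <= 1) -> ~ bounded_sums (fun t => b t.+1) ->
    cvgn (fun N => \sum_(0 <= t < N) a t * X t) ->
  lowpass b a X t @[t --> \oo] --> 0.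
Proof.
move=> b01 nb /cvg_ex[l Ml].
pose N t := \sum_(0 <= s < t.+1) a s * X s - l.
have N0 : N t @[t --> \oo] --> 0.
  by rewrite -(subrr l); apply: cvgB; [rewrite (cvg_shiftS (fun t => \sum_(0 <= s < t) a s * X s))|exact: cvg_cst].
pose u t := lowpass b a X t - N t.
have uS t : u t.+1 = (1 - b t.+1) * u t - b t.+1 * N t.
  by rewrite /u /N /= [in LHS]big_nat_recr//=; ring.
have u_cvg0 : u t @[t --> \oo] --> 0.
  apply/cvgr0Pnorm_le => e e0.
  have e2 : 0 < e / 2 by rewrite divr_gt0.
  move/cvgr0Pnorm_le : N0 => /(_ _ e2)[T _ NT].
  have step t : (T <= t)%N -> `|u t.+1| <= (1 - b t.+1) * `|u t| + b t.+1 * (e / 2).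
    move=> Tt; have /andP[b0 b1] := b01 t.+1.
    rewrite uS (le_trans (ler_normB _ _))// !normrM (ger0_norm b0).
    by rewrite ger0_norm ?subr_ge0// lerD2l ler_wpM2l// NT.
  (* As long as [|u t| > e], each step lowers [|u t|] by at least [b t.+1 * (e / 2)], which cannot
     go on forever. *)
  have [t0 Tt0 ut0] : exists2 t0, (T <= t0)%N & `|u t0| <= e.
    apply: contrapT => nsmall.
    have big t : (T <= t)%N -> e < `|u t|.
      by move=> Tt; rewrite ltNge; apply/negP => ut; apply: nsmall; exists t.
    apply: nb; have [C HC] : bounded_sums (fun t => b (T + t).+1 * (e / 2)).
      exists `|u T| => K.
      suff : \sum_(0 <= t < K) b (T + t).+1 * (e / 2) + `|u (T + K)%N| <= `|u T|.
        by apply: le_trans; rewrite lerDl.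
      elim: K => [|K ih]; first by rewrite big_geq// add0r addn0.
      rewrite big_nat_recr//= addnS; apply: le_trans ih.
      have := step (T + K)%N (leq_addr _ _).
      have := big (T + K)%N (leq_addr _ _).
      have /andP[b0 b1] := b01 (T + K).+1.
      have : b (T + K).+1 * e <= b (T + K).+1 * `|u (T + K)%N|.
        by rewrite ler_wpM2l// ltW// big// leq_addr.
      move: (b (T + K).+1) `|u (T + K)%N| `|u (T + K).+1| (\sum_(_ <= _ < _) _) => *.
      nra.
    have bb t : 0 <= b t by case/andP: (b01 t).
    exists (\sum_(0 <= t < T) b t.+1 + C / (e / 2)) => K.
    have : \sum_(0 <= t < K) b t.+1 <= \sum_(0 <= t < T + K) b t.+1.
      rewrite (big_cat_nat (leq0n K) (leq_addl T K))/= lerDl.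
      by apply: sumr_ge0.
    move/le_trans; apply; rewrite (big_cat_nat (leq0n T) (leq_addr K T))/= lerD2l.
    rewrite ler_pdivlMr// mulr_suml; apply: le_trans (HC K).
    rewrite -{1}[T]add0n big_addn addKn.
    by apply: ler_sum => t _; rewrite addnC.
  (* The bound [e] persists because [(1 - b) * e + b * (e / 2) <= e]. *)
  exists t0 => // t /= t0t.
  elim: t t0t => [|t ih]; first by rewrite leqn0 => /eqP <-.
  rewrite leq_eqVlt => /orP[/eqP <-//|t0t].
  have := ih t0t; have := step t (leq_trans Tt0 t0t).
  have /andP[b0 b1] := b01 t.+1.
  have : (1 - b t.+1) * `|u t| <= (1 - b t.+1) * e by rewrite ler_wpM2l ?subr_ge0// ih.
  move: (b t.+1) b0 b1 ((1 - b t.+1) * `|u t|) => *; nra.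
have -> : lowpass b a X = u \+ N by apply/funext => t; rewrite /u /= subrK.
by rewrite -(addr0 (0 : R)); exact: cvgD.
Qed.

End RealSequences.

(** * Perturbed gradient descent *)

Section Descent.
Variables (R : realType) (d : nat).
Implicit Types (u v h : 'rV[R]_d) (F : 'rV[R]_d -> R).

Definition dot u v : R := \sum_(j < d) u 0 j * v 0 j.

Lemma dot_le u v : `|dot u v| <= d%:R * (`|u| * `|v|).
Proof.
apply: (le_trans (ler_norm_sum _ _ _)).
apply: (@le_trans _ _ (\sum_(j < d) `|u| * `|v|)).
  by apply: ler_sum => j _; rewrite normrM ler_pM// coord_le_norm.
by rewrite sumr_const card_ord mulr_natl.
Qed.

Lemma dotDr u v h : dot u (v + h) = dot u v + dot u h.
Proof. by rewrite -big_split; apply: eq_bigr => j _; rewrite mxE mulrDr. Qed.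

Lemma dotNZ (c : R) u v : dot (- (c *: u)) v = - (c * dot u v).
Proof.
rewrite /dot mulr_sumr -sumrN; apply: eq_bigr => j _.
by rewrite !mxE mulNr mulrA.
Qed.

Lemma dot_sumr (n : nat) u (w : 'I_n -> 'rV[R]_d) :
  dot u (\sum_i w i) = \sum_i dot u (w i).
Proof.
rewrite exchange_big; apply: eq_bigr => j _.
by rewrite summxE mulr_sumr.
Qed.

Lemma dotZr (c : R) u v : dot u (c *: v) = c * dot u v.
Proof.
by rewrite /dot mulr_sumr; apply: eq_bigr => j _; rewrite !mxE; ring.
Qed.

Lemma derive_dot F v h : differentiable F v -> 'D_h F v = dot h (grad F v).
Proof.
move=> dF; rewrite deriveE// {1}[h]row_sum_delta linear_sum.
by apply: eq_bigr => j _; rewrite linearZ /= mxE deriveE.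
Qed.

(** By the mean value theorem on the segment, the increment uses the gradient at an intermediate
    point, which differs from the one at [v] by at most [L * |h|]. The factor [d] is the price of
    bounding [dot] by sup norms. *)
Lemma gradient_increment F (L : R) v h :
    (forall u, differentiable F u) -> 0 <= L ->
    (forall u u', `|grad F u - grad F u'| <= L * `|u - u'|) ->
  F (v + h) <= F v + dot h (grad F v) + d%:R * L * `|h| ^+ 2.
Proof.
move=> dF L0 lip.
pose phi (s : R) := F (v + s *: h).
have dphi (s : R) : is_derive s 1 phi (dot h (grad F (v + s *: h))).
  have quot : (fun k : R => k^-1 *: ((phi \o shift s) (k *: 1) - phi s)) =
      (fun k : R => k^-1 *: ((F \o shift (v + s *: h)) (k *: h) - F (v + s *: h))).
    apply/funext => k; rewrite /phi /= [k *: 1]mulr1.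
    by rewrite scalerDl addrCA.
  split; first by rewrite /derivable quot; exact: diff_derivable.
  by rewrite /derive quot -derive_dot.
have [c] : exists2 c, c \in `[0, 1]%R &
    phi 1 - phi 0 = dot h (grad F (v + c *: h)) * (1 - 0).
  apply: MVT_segment => //; apply: derivable_within_continuous => s _.
  exact: ex_derive.
rewrite in_itv/= => /andP[c0 c1].
rewrite /phi scale1r scale0r addr0 subr0 mulr1 => incr.
have -> : F (v + h) = F v + dot h (grad F (v + c *: h)) by rewrite -incr; ring.
rewrite -addrA lerD2l -lerBlDl.
have -> : dot h (grad F (v + c *: h)) - dot h (grad F v) =
    dot h (grad F (v + c *: h) - grad F v).
  have := dotDr h (grad F (v + c *: h) - grad F v) (grad F v).
  by rewrite subrK => ->; rewrite addrK.
apply: (le_trans (ler_norm _)); apply: (le_trans (dot_le _ _)).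
rewrite -mulrA ler_wpM2l// expr2 mulrCA ler_wpM2l//.
apply: (le_trans (lip _ _)); rewrite ler_wpM2l// addrAC subrr add0r normrZ.
by rewrite ler_piMl// ger0_norm.
Qed.

Lemma dot_self_ge v : `|v| ^+ 2 <= dot v v.
Proof.
have dv0 : 0 <= dot v v by apply: sumr_ge0 => j _; rewrite -expr2 sqr_ge0.
rewrite -[leRHS]sqr_sqrtr// lerXn2r ?nnegrE ?sqrtr_ge0//.
apply: norm_le_coord => [|j]; first exact: sqrtr_ge0.
rewrite -sqrtr_sqr ler_wsqrtr// /dot (bigD1 j)//= -expr2 lerDl.
by apply: sumr_ge0 => k _; rewrite -expr2 sqr_ge0.
Qed.

(** Young's inequality for [dot e v], combined with the comparison of [dot] and the sup norm, which
    costs a factor [d] on [e] only. *)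
Lemma dot_perturbed_ge v e :
  `|v| ^+ 2 / 2 - d%:R * `|e| ^+ 2 / 2 <= dot (v + e) v.
Proof.
have ee : dot e e <= d%:R * `|e| ^+ 2.
  by apply: (le_trans (ler_norm _)); rewrite expr2 dot_le.
have young : - (dot v v + dot e e) / 2 <= dot e v.
  rewrite /dot -big_split/= -sumrN mulr_suml; apply: ler_sum => j _.
  have := sqr_ge0 (v 0 j + e 0 j); nra.
have -> : dot (v + e) v = dot v v + dot e v.
  by rewrite /dot -big_split; apply: eq_bigr => j _; rewrite mxE mulrDl.
have := dot_self_ge v; lra.
Qed.

(** Here [N * G] acts as the gradient of [F]. Each step lowers [F] by [N / 2 * a * |G| ^+ 2] up to
    summable errors. Telescoping bounds [F] from above and, with the lower bound [m], bounds the
    sums of [a * |G| ^+ 2]; since [|G|] moves by at most [L * M * a] per step, it tends to 0. *)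
Lemma perturbed_descent F (G : 'rV[R]_d -> 'rV[R]_d) (N C L M m : R)
    (a : nat -> R) (v e : nat -> 'rV[R]_d) :
    0 < N -> 0 <= C -> 0 <= L ->
    (forall u h, F (u + h) <= F u + N * dot h (G u) + C * `|h| ^+ 2) ->
    (forall u u', `|G u - G u'| <= L * `|u - u'|) ->
    (forall u, m <= F u) ->
    (forall t, 0 <= a t) -> bounded_sums (fun t => a t ^+ 2) ->
    ~ bounded_sums a ->
    (forall t, v t.+1 = v t - a t *: (G (v t) + e t)) ->
    (forall t, `|G (v t) + e t| <= M) ->
    bounded_sums (fun t => a t * `|e t| ^+ 2) ->
  (exists U, forall t, F (v t) <= U) /\ G (v t) @[t --> \oo] --> (0 : 'rV[R]_d).
Proof.
move=> N0 C0 L0 descent lip mF a0 ba2 nba vS GM be.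
have step t : F (v t.+1) + N / 2 * (a t * `|G (v t)| ^+ 2) <=
    F (v t) + (N * d%:R / 2 * (a t * `|e t| ^+ 2) + C * M ^+ 2 * a t ^+ 2).
  have := descent (v t) (- (a t *: (G (v t) + e t))); rewrite -vS dotNZ => h1.
  have h2 := dot_perturbed_ge (G (v t)) (e t).
  have h3 : `|- (a t *: (G (v t) + e t))| ^+ 2 <= M ^+ 2 * a t ^+ 2.
    rewrite normrN normrZ exprMn real_normK ?num_real// mulrC.
    rewrite ler_wpM2r ?sqr_ge0// lerXn2r ?nnegrE//.
    by apply: le_trans (GM t).
  have h4 : C * `|- (a t *: (G (v t) + e t))| ^+ 2 <= C * (M ^+ 2 * a t ^+ 2).
    by rewrite ler_wpM2l.
  have h5 : N * a t * (`|G (v t)| ^+ 2 / 2 - d%:R * `|e t| ^+ 2 / 2) <=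
      N * a t * dot (G (v t) + e t) (G (v t)).
    by rewrite ler_wpM2l// mulr_ge0// ltW.
  lra.
pose eta t := N * d%:R / 2 * (a t * `|e t| ^+ 2) + C * M ^+ 2 * a t ^+ 2.
have [H etaH] : bounded_sums eta.
  apply: bounded_sumsD; apply: bounded_sumsZ => //.
    by rewrite !mulr_ge0 ?invr_ge0// ltW.
  by rewrite mulr_ge0// sqr_ge0.
have N2 : 0 < N / 2 by rewrite divr_gt0.
have ag0 t : 0 <= a t * `|G (v t)| ^+ 2 by rewrite mulr_ge0// sqr_ge0.
have total t : F (v t) + N / 2 * \sum_(0 <= s < t) a s * `|G (v s)| ^+ 2 <=
    F (v 0%N) + H.
  apply: (@le_trans _ _ (F (v 0%N) + \sum_(0 <= s < t) eta s)); last first.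
    by rewrite lerD2l.
  elim: t => [|t ih]; first by rewrite !big_geq// mulr0.
  by rewrite !big_nat_recr//= mulrDr; have := step t; rewrite -/(eta t); lra.
split.
  exists (F (v 0%N) + H) => t; apply: le_trans (total t); rewrite lerDl.
  by rewrite mulr_ge0 ?(ltW N2)// sumr_ge0.
have bag : bounded_sums (fun t => a t * `|G (v t)| ^+ 2).
  exists ((F (v 0%N) + H - m) / (N / 2)) => t.
  by rewrite ler_pdivlMr// mulrC; have := total t; have := mF (v t); lra.
apply/norm_cvg0P.
apply: (@slow_square_summable_cvg0 _ (fun t => `|G (v t)|) a (L * M)) => //.
move=> t; apply: (le_trans (ler_dist_dist _ _)).
apply: (le_trans (lip _ _)); rewrite vS addrAC subrr add0r normrN normrZ.
by rewrite ger0_norm// -mulrA ler_wpM2l// mulrC ler_wpM2r.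
Qed.

End Descent.

(** * Limit sets of walks with vanishing steps *)

Section LimitSet.
Variables (R : realType) (d : nat).
Implicit Types (u : nat -> 'rV[R]_d) (q : 'rV[R]_d) (A : set 'rV[R]_d).

Definition limit_set u : set 'rV[R]_d :=
  [set q | forall e, 0 < e -> forall N, exists2 t, (N <= t)%N & `|u t - q| < e].

(** The tails of [u] along the times in [I] generate a proper filter on a compact cube, which
    therefore clusters. *)
Lemma frequent_limit u (I : nat -> Prop) (r : R) :
    (forall t, `|u t| <= r) -> (forall N, exists2 t, (N <= t)%N & I t) ->
  exists q, forall e, 0 < e -> forall N,
    exists t, [/\ (N <= t)%N, I t & `|u t - q| < e].
Proof.
move=> ur freq.
pose F : set_system 'rV[R]_d :=
  [set P | exists N, forall t, (N <= t)%N -> I t -> P (u t)].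
have FF : ProperFilter F.
  split; first by case=> N FN; have [t Nt It] := freq N; exact: (FN t).
  split.
  - by exists 0%N.
  - move=> P Q [N PN] [M QM]; exists (maxn N M) => t; rewrite geq_max.
    by move=> /andP[Nt Mt] It; split; [exact: PN|exact: QM].
  - by move=> P Q PQ [N PN]; exists N => t Nt It; apply: PQ; exact: PN.
pose K := [set v : 'rV[R]_d | forall j, `[- r, r]%classic (v ord0 j)].
have cK : compact K.
  by apply: (@rV_compact R d (fun=> `[- r, r]%classic)) => j; exact: segment_compact.
have FK : F K.
  exists 0%N => t _ _ j /=; rewrite in_itv/= -ler_norml.
  exact: (le_trans (coord_le_norm (u t) j) (ur t)).
have [q [_ clq]] := cK F FF FK.
exists q => e e0 N.
have FN : F [set v | exists t, [/\ (N <= t)%N, I t & v = u t]].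
  by exists N => t Nt It; exists t.
have qB : nbhs q (ball q e) by exact: nbhsx_ballx.
have [v [[t [Nt It ->]] qt]] := clq _ _ FN qB.
by exists t; split => //; move: qt; rewrite -ball_normE /= distrC.
Qed.

(** Otherwise infinitely many points stay away from the limit set, yet they accumulate by
    [frequent_limit] at one of its members. *)
Lemma limit_set_approach u (r e : R) : (forall t, `|u t| <= r) -> 0 < e ->
  \forall t \near \oo, exists2 q, limit_set u q & `|u t - q| < e.
Proof.
move=> ur e0; apply: contrapT => nfar.
have freq N : exists2 t, (N <= t)%N &
    ~ exists2 q, limit_set u q & `|u t - q| < e.
  apply: contrapT => h; apply: nfar; exists N => // t Nt.
  by apply: contrapT => nt; apply: h; exists t.
have [q qcl] := frequent_limit ur freq.
have [t [_ nt qt]] := qcl e e0 0%N; apply: nt; exists q => // e' e'0 N.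
by have [s [Ns _ sq]] := qcl e' e'0 N; exists s.
Qed.

Lemma limit_set_nonempty u (r : R) : (forall t, `|u t| <= r) ->
  limit_set u !=set0.
Proof.
move=> ur; have [N _ /(_ N (leqnn N))[q uq _]] := limit_set_approach ur ltr01.
by exists q.
Qed.

Lemma limit_set_closed u : closed (limit_set u).
Proof.
move=> q clq e e0 N.
have e2 : 0 < e / 2 by rewrite divr_gt0.
have [q' [uq' qq']] := clq _ (nbhsx_ballx q _ e2).
have [t Nt tq'] := uq' _ e2 N; exists t => //.
move: qq'; rewrite -ball_normE /= distrC => qq'.
rewrite -(subrKA q') (le_lt_trans (ler_normD _ _))//.
by rewrite [ltRHS](splitr e) ltrD.
Qed.

Lemma limit_set_cvg u l : u t @[t --> \oo] --> l -> limit_set u l.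
Proof.
move=> /cvgrPdist_lt ul e e0 N; have [M _ Ml] := ul e e0.
exists (maxn N M); first exact: leq_maxl.
by rewrite distrC; apply: Ml => /=; exact: leq_maxr.
Qed.

(* A walk with vanishing steps that visits two disjoint open sets infinitely
   often leaves the first one infinitely often, and so accumulates outside. *)
Lemma limit_set_connected u (r : R) : (forall t, `|u t| <= r) ->
  u t.+1 - u t @[t --> \oo] --> (0 : 'rV[R]_d) -> connected (limit_set u).
Proof.
move=> ur step D [q1 Dq1] [Y oY DY] [Z cZ DZ].
apply/seteqP; split=> [q|q2 uq2]; first by rewrite DY => -[].
apply: contrapT => nDq2.
(* [D] is open and closed in the limit set. If it misses [q2], normality separates it from the rest
   of the limit set by disjoint open sets. *)
have D' : closed (limit_set u `\` Y).
  by rewrite setDE; apply: closedI; [exact: limit_set_closed|exact: open_closedC].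
have cD : closed D.
  by rewrite DZ; apply: closedI => //; exact: limit_set_closed.
have DD' : D `&` (limit_set u `\` Y) = set0.
  by rewrite -subset0 => q [Dq [_ nYq]]; move: Dq; rewrite DY => -[].
have sep := (@normal_openP R 'rV[R]_d).1 (@pseudometric_normal R 'rV[R]_d).
have [U [V [oU oV DU DV UV]]] := sep _ _ cD D' DD'.
have q2V : V q2.
  by apply: DV; split => // Yq2; apply: nDq2; rewrite DY.
have visit q X : open X -> X q -> limit_set u q ->
    forall N, exists2 t, (N <= t)%N & X (u t).
  move=> oX Xq uq N; have : nbhs q X by exact: open_nbhs_nbhs.
  move=> /nbhs_ballP[e /= e0 eX]; have [t Nt tq] := uq e e0 N.
  by exists t => //; apply: eX; rewrite -ball_normE /= distrC.
have uq1 : limit_set u q1 by move: Dq1; rewrite DY => -[].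
have freq N : exists2 t, (N <= t)%N & U (u t) /\ ~ U (u t.+1).
  have [t1 Nt1 Ut1] := visit q1 U oU (DU _ Dq1) uq1 N.
  have [t2 t12 Vt2] := visit q2 V oV q2V uq2 t1.
  have nUt2 : ~ U (u t2).
    by move=> Ut2; have : (U `&` V) (u t2) by []; rewrite UV.
  apply: contrapT => nexit.
  have stay k : U (u (t1 + k)%N).
    elim: k => [|k ih]; first by rewrite addn0.
    apply: contrapT => nU; apply: nexit; exists (t1 + k)%N.
      exact: leq_trans Nt1 (leq_addr _ _).
    by rewrite -addnS.
  by apply: nUt2; rewrite -(subnKC t12); exact: stay.
(* The last points before exits from [U] accumulate at [q]. If [q] is in [D], the vanishing steps
   keep the next point in [U]; otherwise [q] is in [V], which these points, lying in [U], cannot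
   enter. *)
have [q qcl] := frequent_limit ur freq.
have uq : limit_set u q.
  by move=> e e0 N; have [t [Nt _ tq]] := qcl e e0 N; exists t.
have [Dq|nDq] := pselect (D q).
  have : nbhs q U by apply: open_nbhs_nbhs; split => //; exact: DU.
  move=> /nbhs_ballP[e /= e0 eU].
  have e2 : 0 < e / 2 by rewrite divr_gt0.
  move/cvgr0Pnorm_lt : step => /(_ _ e2)[N _ stepN].
  have [t [Nt [_ nUt] tq]] := qcl _ e2 N; apply: nUt; apply: eU.
  rewrite -ball_normE /= distrC -(subrKA (u t)) (le_lt_trans (ler_normD _ _))//.
  by rewrite [ltRHS](splitr e) ltrD//; exact: stepN.
have Vq : V q by apply: DV; split => // Yq; apply: nDq; rewrite DY.
have : nbhs q V by exact: open_nbhs_nbhs.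
move=> /nbhs_ballP[e /= e0 eV]; have [t [_ [Ut _] tq]] := qcl e e0 0%N.
have : (U `&` V) (u t); last by rewrite UV.
by split => //; apply: eV; rewrite -ball_normE /= distrC.
Qed.

Lemma cvg_to_set_approach u A :
    (forall e, 0 < e -> \forall t \near \oo, exists2 q, A q & `|u t - q| < e) ->
  cvg_to_set u A.
Proof.
move=> uA.
(* With [d + 1] in place of [d] the divisor is positive in dimension 0 too. *)
have d1 : 0 < d%:R + 1 :> R by rewrite ltr_wpDl.
have near0 e : 0 < e -> \forall t \near \oo,
    edist_set A (u t) \is a fin_num /\ `|0 - fine (edist_set A (u t))| < e.
  move=> e0; have ed : 0 < e / (d%:R + 1) by rewrite divr_gt0.
  apply: filterS (uA _ ed) => t [q Aq qt].
  have small : enorm (u t - q) < e.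
    apply: (le_lt_trans (enorm_le_norm _)).
    apply: (@le_lt_trans _ _ ((d%:R + 1) * `|u t - q|)).
      by rewrite ler_wpM2r// lerDl.
    by rewrite mulrC -ltr_pdivlMr.
  have lo : (0 <= edist_set A (u t))%E.
    by apply: le_ereal_inf_tmp => _ [q' _ <-]; rewrite lee_fin; exact: enorm_ge0.
  have hi : (edist_set A (u t) <= (enorm (u t - q))%:E)%E.
    by apply: ereal_inf_lbound; exists q.
  have fn : edist_set A (u t) \is a fin_num.
    by rewrite ge0_fin_numE// (le_lt_trans hi)// ltry.
  split => //; rewrite sub0r normrN ger0_norm ?fine_ge0//.
  by rewrite -lte_fin fineK// (le_lt_trans hi)// lte_fin.
apply/fine_cvgP; split; first by apply: filterS (near0 1 ltr01) => t [].
by apply/cvgrPdist_lt => e /near0; apply: filterS => t [].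
Qed.

Lemma cvg_coord u : (forall j, cvgn (fun t => u t 0 j)) -> cvgn u.
Proof.
move=> cu; apply/cvg_ex; exists (\row_j limn (fun t => u t 0 j)).
apply/cvgrPdist_le => e e0.
have : \forall t \near \oo, forall j, `|limn (fun t => u t 0 j) - u t 0 j| <= e.
  apply: filter_forall => j.
  by move: e e0; apply/cvgrPdist_le; exact: cu.
apply: filterS => t ut; apply: norm_le_coord => [|j]; first exact: ltW.
by rewrite !mxE.
Qed.

(** While [u] stays in the ball it moves only by the terms of a convergent series. Starting within
    [e / 4] of [q] at a time when the partial sums are within [e / 4] of their limit, it stays
    within [3 * e / 4] and never leaves. *)
Lemma cvg_absorbed u (f : 'rV[R]_d -> 'rV[R]_d) (a : nat -> R)
    (nu : nat -> 'rV[R]_d) q (e : R) :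
    (forall t, u t.+1 = u t - a t *: f (u t) - nu t) ->
    cvgn (fun N => \sum_(0 <= t < N) nu t) ->
    limit_set u q -> 0 < e -> (forall v, `|v - q| < e -> f v = 0) ->
  cvgn u.
Proof.
move=> uS cs uq e0 f0.
set s := (fun N => \sum_(0 <= t < N) nu t) in cs.
have e4 : 0 < e / 4 by rewrite divr_gt0.
have /cvg_ex[l sl] := cs.
have /cvgrPdist_lt/(_ _ e4)[T _ Tl] := sl.
have [t0 Tt0 ut0] := uq _ e4 T.
have sS t : s t.+1 = s t + nu t by rewrite /s big_nat_recr.
have stay k : u (t0 + k)%N = u t0 + s t0 - s (t0 + k)%N.
  elim: k => [|k ih]; first by rewrite addn0 addrK.
  rewrite addnS uS f0 ?scaler0 ?subr0; first by rewrite ih sS opprD addrA.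
  have -> : u (t0 + k)%N - q = (u t0 - q) + (l - s (t0 + k)%N) - (l - s t0).
    by rewrite ih; apply/rowP => j; rewrite !mxE; ring.
  have := Tl t0 Tt0; have := Tl _ (leq_trans Tt0 (leq_addr k t0)) => /= h1 h2.
  apply: (le_lt_trans (ler_normB _ _)).
  have := ler_normD (u t0 - q) (l - s (t0 + k)%N).
  move: ut0 h1 h2 e0; lra.
apply/cvg_ex; exists (u t0 + s t0 - l).
rewrite -(cvg_shiftn t0).
have -> : (fun n => u (n + t0)%N) = (fun n => u t0 + s t0 - s (n + t0)%N).
  by apply/funext => n; rewrite addnC stay.
by apply: cvgB; [exact: cvg_cst|rewrite (cvg_shiftn t0 s)].
Qed.

End LimitSet.

Section Average.
Variables (R : realType) (d n : nat).
Implicit Types v : 'I_n -> 'rV[R]_d.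

Lemma averageB v v' : average v - average v' = average (fun i => v i - v' i).
Proof. by rewrite /average -scalerBr sumrB. Qed.

Lemma average_norm_le v (c : R) : (0 < n)%N -> (forall i, `|v i| <= c) ->
  `|average v| <= c.
Proof.
move=> n0 vc; rewrite /average normrZ ger0_norm ?invr_ge0//.
rewrite mulrC ler_pdivrMr ?ltr0n//; apply: (le_trans (ler_norm_sum _ _ _)).
apply: (@le_trans _ _ (\sum_(i < n) c)); first by apply: ler_sum => i _.
by rewrite sumr_const card_ord mulr_natr.
Qed.

Lemma average_norm_le_sum v : (0 < n)%N -> `|average v| <= \sum_i `|v i|.
Proof.
move=> n0; apply: average_norm_le => // i; rewrite (bigD1 i)//= lerDl.
exact: sumr_ge0.
Qed.

End Average.

Lemma row_norm_le_sum (R : realType) (d : nat) (v : 'rV[R]_d) :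
  `|v| <= \sum_j `|v 0 j|.
Proof.
apply: norm_le_coord => [|j]; first exact: sumr_ge0.
by rewrite (bigD1 j)//= lerDl sumr_ge0.
Qed.

Lemma cvgn_sum (R : realType) (I : Type) (s : seq I) (u : I -> nat -> R)
    (l : I -> R) : (forall i, u i t @[t --> \oo] --> l i) ->
  \sum_(i <- s) u i t @[t --> \oo] --> \sum_(i <- s) l i.
Proof.
move=> ul; elim: s => [|i s ih].
  by rewrite big_nil; under eq_fun do rewrite big_nil; exact: cvg_cst.
by rewrite big_cons; under eq_fun do rewrite big_cons; exact: cvgD.
Qed.

(** The given constants may be negative, hence the absolute values. The factor [d] passes from the
    Euclidean to the sup norm, and the sum over the nodes serves all of them. *)
Lemma common_lipschitz (R : realType) (n d : nat)
    (f : 'I_n -> 'rV[R]_d -> 'rV[R]_d) : (forall i, elipschitz (f i)) ->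
  exists2 L : R, 0 <= L & forall i u v, `|f i u - f i v| <= L * `|u - v|.
Proof.
move=> lip; pose l i := sval (cid (lip i)).
have lE i u v : `|f i u - f i v| <= `|l i| * d%:R * `|u - v|.
  apply: (le_trans (norm_le_enorm _)); apply: (le_trans (svalP (cid (lip i)) u v)).
  apply: (le_trans (ler_wpM2r (enorm_ge0 _) (ler_norm _))).
  by rewrite -mulrA ler_wpM2l// enorm_le_norm.
exists (\sum_i `|l i| * d%:R) => [|i u v].
  by apply: sumr_ge0 => i _; rewrite mulr_ge0.
apply: (le_trans (lE i u v)); rewrite ler_wpM2r// (bigD1 i)//= lerDl.
by apply: sumr_ge0 => j _; rewrite mulr_ge0.
Qed.

(** * Convergence of a sample path *)

Section Pathwise.
Variables (R : realType) (n d S : nat) (F : 'I_n -> 'rV[R]_d -> R).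
Variables (a : nat -> R) (E : nat -> rel 'I_n).
Variables (W : 'I_n -> nat -> 'rV[R]_d) (x0 : 'I_n -> 'rV[R]_d).
Variables (x w z : 'I_n -> nat -> 'rV[R]_d) (y : 'I_n -> nat -> R).
Let f i := grad (F i).
Let Ftot v := \sum_(i < n) F i v.
Let G v := average (fun i => f i v).
Let B := [set v | G v = 0].
Let xbar t := average (fun i => x i t).
Hypothesis n_gt0 : (0 < n)%N.
Hypothesis F_diff : forall i v, differentiable (F i) v.
Variables K L : R.
Hypothesis K_ge0 : 0 <= K.
Hypothesis f_bounded : forall i v, enorm (f i v) <= K.
Hypothesis L_ge0 : 0 <= L.
Hypothesis f_lipschitz : forall i u v, `|f i u - f i v| <= L * `|u - v|.
Hypothesis F_coercive : coercive Ftot.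
Hypothesis F_min : exists v0, forall v, Ftot v0 <= Ftot v.
Hypothesis a_pos : forall t, 0 < a t.
Hypothesis a_noninc : nonincreasing_seq a.
Hypothesis a_sum : ~ bounded_sums a.
Hypothesis a_sqr : bounded_sums (fun t => a t ^+ 2).
Hypothesis conn : S_strongly_connected S E.
Hypothesis PS : push_sum E a f W x0 x w z y.

(** The first step size is the largest, so dividing by it puts the filter weights in the unit
    interval. *)
Let b t := a t / a 0%N.
Let r i j t := lowpass b a (fun t => W i t 0 j) t.

Hypothesis W_sqr : forall i j, bounded_sums (fun t => (a t * W i t 0 j) ^+ 2).
Hypothesis W_low : forall i j, bounded_sums (fun t => b t.+1 * r i j t ^+ 2).
Hypothesis W_cvg : forall i j, cvgn (fun N => \sum_(0 <= t < N) a t * W i t 0 j).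

Let rbar t := average (fun i => \row_j r i j t).
Let rho t := \sum_i \sum_j `|r i j t|.

Let a0_gt0 : 0 < a 0%N. Proof. exact: a_pos. Qed.

Let bE t : a t = a 0%N * b t.
Proof. by rewrite /b mulrC divfK// gt_eqF. Qed.

Let b01 t : 0 <= b t <= 1.
Proof.
apply/andP; split; first by rewrite divr_ge0// ltW.
by rewrite ler_pdivrMr// mul1r; exact: a_noninc.
Qed.

Let aS_sum : ~ bounded_sums (fun t => a t.+1).
Proof.
move=> [C aC]; apply: a_sum; exists (a 0%N + C) => -[|N].
  rewrite big_geq//; apply: addr_ge0; first exact: ltW.
  by have := aC 0%N; rewrite big_geq.
by rewrite big_nat_recl// lerD2l.
Qed.

Let r_cvg0 i j : r i j t @[t --> \oo] --> 0.
Proof.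
apply: lowpass_cvg0 => // bb; apply: aS_sum.
have := bounded_sumsZ (ltW a0_gt0) bb; apply: bounded_sums_le => t.
by rewrite -bE.
Qed.

Let rho_ge0 t : 0 <= rho t.
Proof. by apply: sumr_ge0 => i _; apply: sumr_ge0. Qed.

Let rho_cvg0 : rho t @[t --> \oo] --> 0.
Proof.
have -> : 0 = \sum_(i < n) \sum_(j < d) 0 :> R.
  by rewrite big1// => i _; rewrite big1.
apply: cvgn_sum => i; apply: cvgn_sum => j.
by rewrite -(normr0 R); apply: cvg_norm; exact: r_cvg0.
Qed.

Let rbar_le t : `|rbar t| <= rho t.
Proof.
apply: (le_trans (average_norm_le_sum _ n_gt0)); apply: ler_sum => i _.
apply: (le_trans (row_norm_le_sum _)).
by apply: ler_sum => j _; rewrite mxE.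
Qed.

Let rho_sqr : bounded_sums (fun t => b t.+1 * rho t ^+ 2).
Proof.
(* The weight enters each summand as a square root, so that finite sums of square-summable sequences
   apply. *)
have bs : bounded_sums (fun t =>
    (\sum_i \sum_j Num.sqrt (b t.+1) * `|r i j t|) ^+ 2).
  apply: square_summable_sum => i; apply: square_summable_sum => j.
  have := W_low i j; apply: bounded_sums_le => t.
  have /andP[b0 _] := b01 t.+1.
  by rewrite exprMn sqr_sqrtr// real_normK ?num_real.
apply: bounded_sums_le bs => t; have /andP[b0 _] := b01 t.+1.
have -> : \sum_i \sum_j Num.sqrt (b t.+1) * `|r i j t| = Num.sqrt (b t.+1) * rho t.
  by rewrite /rho mulr_sumr; apply: eq_bigr => i _; rewrite mulr_sumr.
by rewrite exprMn sqr_sqrtr.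
Qed.

Let rbarS t : rbar t.+1 = rbar t - b t.+1 *: rbar t + a t.+1 *: average (W^~ t.+1).
Proof.
apply/rowP => j; rewrite /rbar /average !mxE !summxE.
rewrite -[X in _ = X]/(_ + _).
have -> : \sum_(i < n) (\row_j r i j t.+1) 0 j =
    (1 - b t.+1) * \sum_(i < n) (\row_j r i j t) 0 j +
    a t.+1 * \sum_(i < n) W i t.+1 0 j.
  rewrite !mulr_sumr -big_split; apply: eq_bigr => i _ /=.
  by rewrite !mxE.
by ring.
Qed.

Let G_descent v h : Ftot (v + h) <=
  Ftot v + n%:R * dot h (G v) +
  n%:R * (d%:R * L) * `|h| ^+ 2.
Proof.
have -> : n%:R * dot h (G v) = \sum_(i < n) dot h (f i v).
  by rewrite -dotZr scalerA mulfV ?scale1r ?dot_sumr// pnatr_eq0 -lt0n.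
have -> : n%:R * (d%:R * L) * `|h| ^+ 2 = \sum_(i < n) (d%:R * L * `|h| ^+ 2).
  by rewrite sumr_const card_ord -mulrA mulr_natl.
rewrite -!big_split; apply: ler_sum => i _ /=.
exact: (gradient_increment v h (F_diff i) L_ge0 (f_lipschitz i)).
Qed.

Let G_lip u v : `|G u - G v| <= L * `|u - v|.
Proof. by rewrite averageB; apply: average_norm_le. Qed.

Let f_norm i v : `|f i v| <= K.
Proof. exact: le_trans (norm_le_enorm _) (f_bounded i v). Qed.

Let fz t := average (fun i => f i (z i t.+1)).
(** Adding [rbar] cancels the raw noise in the step of [xbar]. The price is the leak
    [b t.+1 *: rbar t] of the filter, which becomes the term [(a 0)^-1 *: rbar t] of [e]. *)
Let v t := xbar t + rbar t.
Let e t := (fz t - G (v t)) + (a 0%N)^-1 *: rbar t.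

Let vS t : v t.+1 = v t - a t.+1 *: (G (v t) + e t).
Proof.
rewrite /v /xbar (average_push_sum PS) -/(xbar t) -/(fz t) rbarS /e.
have -> : G (xbar t + rbar t) + (fz t - G (xbar t + rbar t) + (a 0%N)^-1 *: rbar t) =
    fz t + (a 0%N)^-1 *: rbar t by rewrite addrA subrKC.
rewrite scalerDr /b.
by apply/rowP => j; rewrite !mxE; ring.
Qed.

(** The perturbation [e] is controlled by the consensus error [c] and the filtered noise [rho], so
    [perturbed_descent] applies to [v]. Since [rbar] tends to 0, the conclusions pass to [xbar]. *)
Lemma pathwise_descent (c : nat -> R) :
    (forall t, 0 <= c t) -> bounded_sums (fun t => c t ^+ 2) ->
    (forall i t, `|z i t.+1 - xbar t| <= c t) ->
  [/\ exists ub, forall t, `|xbar t| <= ub,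
      xbar t.+1 - xbar t @[t --> \oo] --> (0 : 'rV[R]_d) &
      G (xbar t) @[t --> \oo] --> (0 : 'rV[R]_d)].
Proof.
move=> c0 c2 zc.
have [Rb rhoRb] : exists Rb, forall t, rho t <= Rb.
  have /cvg_seq_bounded[M [_ MP]] : cvgn rho by apply/cvg_ex; exists 0.
  exists (M + 1) => t; apply: (le_trans (ler_norm _)).
  by apply: (MP (M + 1)) => //; rewrite ltrDl.
have Rb0 : 0 <= Rb by apply: le_trans (rhoRb 0%N).
pose k := L + (a 0%N)^-1.
have k0 : 0 <= k by rewrite addr_ge0// invr_ge0 ltW.
have e_le t : `|e t| <= L * c t + k * rho t.
  have h1 : `|fz t - G (v t)| <= L * (c t + rho t).
    rewrite averageB; apply: average_norm_le => // i.
    apply: (le_trans (f_lipschitz _ _ _)); rewrite ler_wpM2l// /v.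
    rewrite opprD addrA; apply: (le_trans (ler_normB _ _)).
    by rewrite lerD// zc.
  have h2 : `|(a 0%N)^-1 *: rbar t| <= (a 0%N)^-1 * rho t.
    by rewrite normrZ ger0_norm ?ler_wpM2l// invr_ge0 ltW.
  apply: (le_trans (ler_normD _ _)); apply: (le_trans (lerD h1 h2)).
  by rewrite /k mulrDr mulrDl addrA.
(* The weight [a t.+1] is bounded by [a 0] next to [c], whose squares are summable, and rewritten as
   [a 0 * b t.+1] next to [rho], for which the weighted sum is known to be bounded. *)
have e_sqr : bounded_sums (fun t => a t.+1 * `|e t| ^+ 2).
  have := bounded_sumsD
    (bounded_sumsZ (_ : 0 <= 2 * L ^+ 2 * a 0%N) c2)
    (bounded_sumsZ (_ : 0 <= 2 * k ^+ 2 * a 0%N) rho_sqr).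
  have p1 : 0 <= 2 * L ^+ 2 * a 0%N by rewrite !mulr_ge0 ?sqr_ge0// ltW.
  have p2 : 0 <= 2 * k ^+ 2 * a 0%N by rewrite !mulr_ge0 ?sqr_ge0// ltW.
  move=> /(_ p1 p2); apply: bounded_sums_le => t.
  have sq : `|e t| ^+ 2 <= 2 * L ^+ 2 * c t ^+ 2 + 2 * k ^+ 2 * rho t ^+ 2.
    apply: (@le_trans _ _ ((L * c t + k * rho t) ^+ 2)).
      by rewrite lerXn2r ?nnegrE// (le_trans _ (e_le t)).
    have := sqr_ge0 (L * c t - k * rho t); nra.
  have aS0 : 0 <= a t.+1 by exact: ltW.
  apply: (le_trans (ler_wpM2l aS0 sq)); rewrite mulrDr; apply: lerD.
    rewrite mulrC [leRHS]mulrAC ler_wpM2l//; last exact: a_noninc.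
    by rewrite !mulr_ge0 ?sqr_ge0.
  by rewrite le_eqVlt; apply/orP; left; apply/eqP; rewrite bE; ring.
have Ge t : G (v t) + e t = fz t + (a 0%N)^-1 *: rbar t by rewrite /e addrA subrKC.
have GM t : `|G (v t) + e t| <= K + (a 0%N)^-1 * Rb.
  rewrite Ge; apply: (le_trans (ler_normD _ _)); apply: lerD.
    exact: average_norm_le.
  rewrite normrZ ger0_norm ?invr_ge0 ?ler_wpM2l ?invr_ge0 ?(ltW a0_gt0)//.
  exact: le_trans (rbar_le t) (rhoRb t).
have [v0 v0min] := F_min.
have aS_ge0 t : 0 <= a t.+1 by exact: ltW.
have nRgt0 : 0 < n%:R :> R by rewrite ltr0n.
have aS2 := bounded_sumsS (fun t => sqr_ge0 (a t)) a_sqr.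
have C_ge0 : 0 <= n%:R * (d%:R * L) by rewrite !mulr_ge0.
have [[U FU] Gv0] := perturbed_descent nRgt0 C_ge0 L_ge0 G_descent G_lip v0min
  aS_ge0 aS2 aS_sum vS GM e_sqr.
have rbar_cvg0 : rbar t @[t --> \oo] --> (0 : 'rV[R]_d).
  apply/cvgr0Pnorm_le => eps eps0; move/cvgr0Pnorm_le : rho_cvg0 => /(_ _ eps0).
  apply: filterS => t; rewrite ger0_norm//; exact: le_trans.
split.
(* Outside radius [rd] the objective is at least [U + 1], a level that it never reaches along
   [v]. *)
- have [rd Frd] := F_coercive (U + 1); exists (rd + Rb) => t.
  have vrd : `|v t| <= rd.
    apply: (le_trans (norm_le_enorm _)); apply: ltW; rewrite ltNge; apply/negP.
    by move=> /Frd; have := FU t; lra.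
  have -> : xbar t = v t - rbar t by rewrite /v addrK.
  apply: (le_trans (ler_normB _ _)); apply: lerD => //.
  exact: le_trans (rbar_le t) (rhoRb t).
- have aM0 : a t.+1 * (K + (a 0%N)^-1 * Rb) @[t --> \oo] --> 0.
    have aSS : a t.+1 @[t --> \oo] --> 0.
      apply/cvgrPdist_le => eps eps0.
      have := bounded_sums_cvg0 (fun t => sqr_ge0 _) aS2.
      move/cvgrPdist_le => /(_ (eps ^+ 2)); rewrite exprn_gt0// => /(_ isT).
      apply: filterS => t; rewrite !sub0r !normrN normrX.
      by rewrite ler_pXn2r ?nnegrE// ltW.
    by rewrite -[X in _ --> X](mul0r (K + (a 0%N)^-1 * Rb)); apply: cvgM => //; exact: cvg_cst.
  have vstep : v t.+1 - v t @[t --> \oo] --> (0 : 'rV[R]_d).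
    apply/cvgr0Pnorm_le => eps eps0; move/cvgr0Pnorm_le : aM0 => /(_ _ eps0).
    apply: filterS => t; apply: le_trans.
    rewrite vS addrAC subrr add0r normrN normrZ ger0_norm//.
    rewrite ger0_norm ?ler_wpM2l//.
    by rewrite mulr_ge0// (le_trans _ (GM t)).
  have rstep : rbar t.+1 - rbar t @[t --> \oo] --> (0 : 'rV[R]_d).
    rewrite -(subrr (0 : 'rV[R]_d)); apply: cvgB => //.
    by rewrite (cvg_shiftS rbar).
  have -> : (fun t => xbar t.+1 - xbar t) =
      (fun t => (v t.+1 - v t) - (rbar t.+1 - rbar t)).
    by apply/funext => t; apply/rowP => j; rewrite /v !mxE; ring.
  by rewrite -(subrr (0 : 'rV[R]_d)); apply: cvgB.
- have diff0 : G (xbar t) - G (v t) @[t --> \oo] --> (0 : 'rV[R]_d).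
    have Lrho : L * rho t @[t --> \oo] --> 0.
      by rewrite -(mulr0 L); apply: cvgM => //; exact: cvg_cst.
    apply/cvgr0Pnorm_le => eps eps0; move/cvgr0Pnorm_le : Lrho => /(_ _ eps0).
    apply: filterS => t; apply: le_trans; rewrite ger0_norm ?mulr_ge0//.
    apply: (le_trans (G_lip _ _)); rewrite ler_wpM2l//.
    by rewrite /v opprD addrA subrr sub0r normrN.
  have -> : (fun t => G (xbar t)) = (fun t => (G (xbar t) - G (v t)) + G (v t)).
    by apply/funext => t; rewrite subrK.
  by rewrite -(addr0 (0 : 'rV[R]_d)); apply: cvgD.
Qed.

Let Wbar_cvg j :
  cvgn (fun N => \sum_(0 <= t < N) (a t.+1 *: average (W^~ t.+1)) 0 j).
Proof.
have one i : cvgn (fun N => \sum_(0 <= t < N) a t.+1 * W i t.+1 0 j).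
  have /cvg_ex[l Wl] := @W_cvg i j; apply/cvg_ex.
  exists (l - a 0%N * W i 0%N 0 j).
  have -> : (fun N => \sum_(0 <= t < N) a t.+1 * W i t.+1 0 j) =
      (fun N => \sum_(0 <= t < N.+1) a t * W i t 0 j - a 0%N * W i 0%N 0 j).
    by apply/funext => N; rewrite [in RHS]big_nat_recl// addrC addKr.
  apply: cvgB; last exact: cvg_cst.
  by rewrite (cvg_shiftS (fun N => \sum_(0 <= t < N) a t * W i t 0 j)).
have -> : (fun N => \sum_(0 <= t < N) (a t.+1 *: average (W^~ t.+1)) 0 j) =
    (fun N => n%:R^-1 * \sum_i \sum_(0 <= t < N) a t.+1 * W i t.+1 0 j).
  apply/funext => N; rewrite exchange_big mulr_sumr; apply: eq_bigr => t _ /=.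
  by rewrite !mxE summxE -mulr_sumr mulrCA.
apply/cvg_ex; exists (n%:R^-1 * \sum_i limn (fun N => \sum_(0 <= t < N) a t.+1 * W i t.+1 0 j)).
by apply: cvgM; [exact: cvg_cst|apply: cvgn_sum => i; exact: (@one i)].
Qed.

Lemma pathwise_convergence :
  (exists2 p, B p & xbar t @[t --> \oo] --> p /\
     forall i, z i t @[t --> \oo] --> p) \/
  (exists2 C, components B C & cvg_to_set xbar (boundary C) /\
     forall i, cvg_to_set (z i) (boundary C)).
Proof.
have [c [c0 c2 zc]] := push_sum_consensus PS n_gt0 conn K_ge0 f_bounded
  (fun t => ltW (a_pos t)) a_sqr W_sqr.
have [[ub xub] xstep Gx0] := pathwise_descent c0 c2 zc.
have zx i : z i t.+1 - xbar t @[t --> \oo] --> (0 : 'rV[R]_d).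
  have c_cvg0 : c t ^+ 2 @[t --> \oo] --> 0.
    by apply: bounded_sums_cvg0 => // t; exact: sqr_ge0.
  apply/cvgr0Pnorm_le => eps eps0.
  move/cvgr0Pnorm_le : c_cvg0 => /(_ (eps ^+ 2)); rewrite exprn_gt0// => /(_ isT).
  apply: filterS => t; rewrite normrX ler_pXn2r ?nnegrE ?(ltW eps0)//.
  by rewrite ger0_norm//; apply: le_trans; exact: zc.
(* At times when [xbar] is close to [q], [G q] is close to [G (xbar t)], which tends to 0. *)
have LB : limit_set xbar `<=` B.
  move=> q xq; apply/eqP; rewrite -normr_le0; apply/ler_addgt0Pr => eps eps0.
  rewrite add0r.
  have L1 : 0 < L + 1 by rewrite ltr_wpDl.
  have e2 : 0 < eps / 2 by rewrite divr_gt0.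
  move/cvgr0Pnorm_le : Gx0 => /(_ _ e2)[N _ GN].
  have eL : 0 < eps / 2 / (L + 1) by rewrite divr_gt0.
  have [t Nt xt] := xq _ eL N.
  rewrite -(subrK (G (xbar t)) (G q)); apply: (le_trans (ler_normD _ _)).
  rewrite [leRHS](splitr eps); apply: lerD; last exact: GN.
  apply: (le_trans (G_lip _ _)); rewrite distrC.
  apply: (@le_trans _ _ ((L + 1) * `|xbar t - q|)).
    by rewrite ler_wpM2r// lerDl.
  by rewrite mulrC -ler_pdivlMr// ltW.
have [p0 xp0] := limit_set_nonempty xub.
pose C := connected_component B p0.
have LC : limit_set xbar `<=` C.
  by apply: connected_component_max => //; exact: (limit_set_connected xub xstep).
have [[q [xq Cq]]|nint] :=
  pselect (exists q, limit_set xbar q /\ (interior C) q); [left|right].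
- have /nbhs_ballP[eps /= eps0 epsC] : nbhs q C by exact: Cq.
  have G0 v' : `|v' - q| < eps -> G v' = 0.
    move=> vq; have Cv : C v' by apply: epsC; rewrite -ball_normE /= distrC.
    exact: (@connected_component_sub _ B p0 _ Cv).
  (* The gradient discrepancy is at most [L * c t], so its product with [a] is absolutely summable,
     and the mean noise has a convergent series in each coordinate. *)
  pose nu t := a t.+1 *: (fz t - G (xbar t)) + a t.+1 *: average (W^~ t.+1).
  have xS t : xbar t.+1 = xbar t - a t.+1 *: G (xbar t) - nu t.
    rewrite {1}/xbar (average_push_sum PS) -/(xbar t) -/(fz t) /nu.
    by apply/rowP => j; rewrite !mxE; ring.
  have cnu : cvgn (fun N => \sum_(0 <= t < N) nu t).
    apply: cvg_coord => j.
    have -> : (fun N => (\sum_(0 <= t < N) nu t) 0 j) =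
        series (fun t => (a t.+1 *: (fz t - G (xbar t))) 0 j) \+
        (fun N => \sum_(0 <= t < N) (a t.+1 *: average (W^~ t.+1)) 0 j).
      apply/funext => N; rewrite seriesEnat /= summxE -big_split.
      by apply: eq_bigr => t _; rewrite mxE.
    apply: is_cvgD; last exact: Wbar_cvg.
    apply: normed_cvg; apply: bounded_sums_series => [t|]; first exact: normr_ge0.
    have aS2 := bounded_sumsS (fun t => sqr_ge0 (a t)) a_sqr.
    have := bounded_sumsZ L_ge0 (bounded_sumsM aS2 c2).
    apply: bounded_sums_le => t /=; apply: (le_trans (coord_le_norm _ _)).
    rewrite normrZ normrM mulrCA ler_wpM2l// (ger0_norm (c0 t)).
    rewrite averageB; apply: average_norm_le => // i.
    by apply: (le_trans (f_lipschitz _ _ _)); rewrite ler_wpM2l.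
  have /cvg_ex[p xp] := cvg_absorbed (a := fun t => a t.+1) xS cnu xq eps0 G0.
  exists p; first by apply: LB; exact: limit_set_cvg.
  split => // i; rewrite -(cvg_shiftS (z i)).
  have -> : [sequence z i t.+1]_t = (fun t => (z i t.+1 - xbar t) + xbar t).
    by apply/funext => t; rewrite subrK.
  by rewrite -(add0r p); apply: cvgD; [exact: zx|exact: xp].
- have Lbd : limit_set xbar `<=` boundary C.
    move=> q xq; split; first by apply: subset_closure; exact: LC.
    by move=> Cq; apply: nint; exists q.
  exists C; first by exists p0 => //; exact: LB.
  split=> [|i]; apply: cvg_to_set_approach => eps eps0.
    apply: filterS (limit_set_approach xub eps0) => t [q xq tq].
    by exists q => //; exact: Lbd.
  have e2 : 0 < eps / 2 by rewrite divr_gt0.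
  have near1 := limit_set_approach xub e2.
  have near2 := zx i; move/cvgr0Pnorm_lt : near2 => /(_ _ e2) near2.
  have [N _ zN] : \forall t \near \oo,
      exists2 q, boundary C q & `|z i t.+1 - q| < eps.
    apply: filterS2 near1 near2 => t [q xq tq] zt; exists q; first exact: Lbd.
    rewrite -(subrKA (xbar t)) (le_lt_trans (ler_normD _ _))//.
    by rewrite [ltRHS](splitr eps) ltrD.
  (* The estimate concerns [z i t.+1]; starting at [N.+1] excludes time 0, where [z] is
     unconstrained. *)
  by exists N.+1 => // -[//|t] /= Nt; exact: zN.
Qed.

End Pathwise.

(** * Almost sure convergence of perturbed push-sum *)

Theorem theorem4 (R : realType) (n d S : nat)
    (F : 'I_n -> 'rV[R]_d -> R)
    (a : nat -> R) (E : nat -> rel 'I_n)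
    (dO : measure_display) (Omega : measurableType dO)
    (P : probability Omega R)
    (W : 'I_n -> nat -> {RV P >-> borel_rV R d})
    (x0 : 'I_n -> 'rV[R]_d)
    (x w z : Omega -> 'I_n -> nat -> 'rV[R]_d) (y : 'I_n -> nat -> R)
    (f := fun i => grad (F i))
    (Ftot := fun v => \sum_(i < n) F i v)
    (B := [set v | average (fun i => f i v) = 0])
    (n_ge1 : (1 <= n)%N) (d_ge1 : (1 <= d)%N) (S_ge1 : (1 <= S)%N)
    (F_diff : forall i v, differentiable (F i) v)
    (f_bounded : exists2 K : R, 0 <= K & forall i v, enorm (f i v) <= K)
    (f_lipschitz : forall i, elipschitz (f i))
    (F_coercive : coercive Ftot)
    (F_min : exists v0, forall v, Ftot v0 <= Ftot v)
    (B_components : finite_set (components B))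
    (W_independent : forall i, mutually_independent P (fun t => W i t))
    (W_identical : forall i, identically_distributed (W i))
    (W_entries : forall i t,
       mutually_independent P (fun (j : 'I_d) om => (W i t om : 'rV[R]_d) 0%R j))
    (W_mean : forall i t j, ('E_P[fun om => (W i t om : 'rV[R]_d) 0%R j] = 0)%E)
    (W_var : forall i t j, ('V_P[fun om => (W i t om : 'rV[R]_d) 0%R j] = 1)%E)
    (a_pos : forall t, 0 < a t)
    (a_noninc : nonincreasing_seq a)
    (a_sum : (\sum_(0 <= t <oo) (a t)%:E = +oo)%E)
    (a_sum2 : (\sum_(0 <= t <oo) ((a t) ^+ 2)%:E < +oo)%E)
    (E_connected : S_strongly_connected S E)
    (algorithm : forall om,
       push_sum E a f (fun i t => W i t om) x0 (x om) (w om) (z om) y)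
    (xbar := fun om t => average (fun i => x om i t)) :
  {ae P, forall om,
    (exists2 b, B b &
       xbar om t @[t --> \oo] --> b /\
       forall i, z om i t @[t --> \oo] --> b) \/
    (exists2 C, components B C &
       cvg_to_set (xbar om) (boundary C) /\
       forall i, cvg_to_set (z om i) (boundary C))}.
Proof.
have a_sqr : bounded_sums (fun t => a t ^+ 2).
  by apply: bounded_sums_nneseries => // t; exact: sqr_ge0.
have a_nsum : ~ bounded_sums a.
  by move=> /(bounded_sums_lty (fun t => ltW (a_pos t))); rewrite a_sum.
have [K K0 fK] := f_bounded.
have [L L0 fL] := common_lipschitz f_lipschitz.
have b01 t : 0 <= a t / a 0%N <= 1.
  apply/andP; split; first by rewrite divr_ge0// ltW.
  by rewrite ler_pdivrMr// mul1r; exact: a_noninc.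
(* There are finitely many nodes and coordinates, so the exceptional events of the single entries
   unite to a null event. *)
have noise : {ae P, forall om, forall i j,
    [/\ bounded_sums (fun t => (a t * (W i t om : 'rV[R]_d) 0 j) ^+ 2),
    bounded_sums (fun t => a t.+1 / a 0%N *
      lowpass (fun t => a t / a 0%N) a (fun t => (W i t om : 'rV[R]_d) 0 j) t ^+ 2) &
    cvgn (fun N => \sum_(0 <= t < N) a t * (W i t om : 'rV[R]_d) 0 j)]}.
  apply: filter_forall => i; apply: filter_forall => j.
  exact: (ae_noise_regular (W_independent i) (fun t => W_mean i t j)
    (fun t => W_var i t j) a_sqr b01).
apply: filterS noise => om reg.
apply: (pathwise_convergence n_ge1 F_diff K0 fK L0 fL F_coercive F_min a_pos
  a_noninc a_nsum a_sqr E_connected (algorithm om)) => i j.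
- by have [] := reg i j.
- by have [] := reg i j.
- by have [] := reg i j.
Qed.
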